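(* Let $P$ be a finite nonempty poset with $p=|P|$, $\Bbbk$ a field, $n\ge1$, and $R=\bigcup_{i=1}^n\{i\}\times R_i\subseteq[n]\times P$. The Betti number $\beta_{p-1,R}(L(n,P))$ is nonzero if and only if - $R_1\le R_2\le\cdots\le R_n$, - $P=R_1\cup R_2\cup\cdots\cup R_n$, - for each $i=1,\ldots,n-1$ we have that $\max(R_i)=\min(R_{i+1})$ is a maximal antichain in $P$. In this case the Betti number $\beta_{p-1,R}(L(n,P))=1$.
   Context: $[n]=\{1<\dots<n\}$. The $n$'th letterplace ideal $L(n,P)$ is the ideal in $S=\Bbbk[x_{i,p}:(i,p)\in[n]\times P]$ generated by the monomials $x_{1,p_1}x_{2,p_2}\cdots x_{n,p_n}$ with $p_1\le p_2\le\cdots\le p_n$ in $P$. It is a Cohen-Macaulay ideal of codimension $|P|$ (known), so its highest homological degree is $|P|-1$. For $R\subseteq[n]\times P$, $\beta_{i,R}(L(n,P))=\dim_\Bbbk\mathrm{Tor}_i^S(L(n,P),\Bbbk)_R$, where the multidegree $R$ means the $0/1$ exponent vector with support $R$. $\max(A)$ and $\min(A)$ denote the sets of maximal, respectively minimal, elements of $A\subseteq P$. A maximal antichain is an antichain that is maximal with respect to inclusion. For nonempty subsets $A,B$ of $P$ write $A\le B$ if: for every $a\in\max(A)$ there is $b\in\min(B)$ with $a\le b$, and for every $b\in\min(B)$ there is $a\in\max(A)$ with $a\le b$. (The first condition includes that all $R_i$ are nonempty.) *)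

(* Defs.v *)
From HB Require Import structures.
From mathcomp Require Export all_boot all_order all_algebra.
From mathcomp Require Export mpoly.

Set Implicit Arguments.
Unset Strict Implicit.
Unset Printing Implicit Defensive.

Import Order.TTheory GRing.Theory.

Section Posets.

Variables (disp : Order.disp_t) (P : finPOrderType disp).
Implicit Types A B : {set P}.

Definition max_elts A : {set P} := [set x in A | [forall y in A, ~~ (x < y)%O]].

Definition min_elts A : {set P} := [set x in A | [forall y in A, ~~ (y < x)%O]].

Definition antichain A : bool :=
  [forall x in A, forall y in A, (x <= y)%O ==> (x == y)].

Definition maximal_antichain A : bool := maxset antichain A.

Definition set_le A B : Prop :=
  [/\ A != set0, B != set0,
      (forall a, a \in max_elts A -> exists2 b, b \in min_elts B & (a <= b)%O)
    & (forall b, b \in min_elts B -> exists2 a, a \in max_elts A & (a <= b)%O)].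

End Posets.

Local Open Scope ring_scope.

(* Multigraded Tor of an ideal against the residue field.  The modules
   F_i = S^(rk i) are finite free over S = k[x_1..x_N]; their elements are row
   vectors and maps act by right multiplication.  The j-th basis vector of F_i
   sits in multidegree [deg i j], so F_i is the sum of the S(- deg i j), and
   the homogeneity fields say that all maps have multidegree 0. *)
Record graded_free_resolution (k : fieldType) (N : nat)
    (I : {mpoly k[N]} -> Prop) := GradedFreeResolution {
  rk : nat -> nat;
  deg : forall i : nat, 'I_(rk i) -> 'X_{1..N};
  diff : forall i : nat, 'M[{mpoly k[N]}]_(rk i.+1, rk i);
  aug : 'cV[{mpoly k[N]}]_(rk 0);
  diff_homogeneous : forall i (a : 'I_(rk i.+1)) (b : 'I_(rk i)) m,
    m \in msupp (diff i a b) -> (m + deg b)%MM = deg a;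
  aug_homogeneous : forall (a : 'I_(rk 0)) m,
    m \in msupp (aug a 0) -> m = deg a;
  aug_image : forall q : {mpoly k[N]},
    I q <-> exists v : 'rV_(rk 0), (v *m aug) 0 0 = q;
  exact_aug : forall v : 'rV_(rk 0),
    v *m aug = 0 <-> exists w : 'rV_(rk 1), v = w *m diff 0;
  exact_diff : forall i (v : 'rV_(rk i.+1)),
    v *m diff i = 0 <-> exists w : 'rV_(rk i.+2), v = w *m diff i.+1 }.

Section Tor.

Variables (k : fieldType) (N : nat) (I : {mpoly k[N]} -> Prop).
Variable F : graded_free_resolution I.

(* The differential of the complex F (x)_S k, where k = S / (x_1, .., x_N), so
   that a polynomial acts through its constant coefficient. *)
Definition diff_k (i : nat) : 'M[k]_(rk F i.+1, rk F i) :=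
  map_mx (mcoeff 0%MM) (diff F i).

(* Its row space is the part of F_i (x)_S k of multidegree m. *)
Definition strand (i : nat) (m : 'X_{1..N}) : 'M[k]_(rk F i) :=
  diag_mx (\row_j (deg j == m)%:R).

Definition cycles (i : nat) (m : 'X_{1..N}) : 'M[k]_(rk F i) :=
  match i with
  | 0 => strand 0 m
  | i'.+1 => (strand i'.+1 m :&: kermx (diff_k i'))%MS
  end.

Definition boundaries (i : nat) (m : 'X_{1..N}) : 'M[k]_(rk F i.+1, rk F i) :=
  strand i.+1 m *m diff_k i.

(* The dimension of Tor_i^S(I, k)_m computed from F: boundaries are cycles, so
   the truncated subtraction is the dimension of the quotient. *)
Definition betti (i : nat) (m : 'X_{1..N}) : nat :=
  (\rank (cycles i m) - \rank (boundaries i m))%N.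

End Tor.

Section Letterplace.

Variables (k : fieldType) (n : nat) (disp : Order.disp_t).
Variable P : finPOrderType disp.

Definition nvars : nat := #|{: 'I_n * P}|.

Definition lvar (i : 'I_n) (p : P) : {mpoly k[nvars]} :=
  'X_(enum_rank (i, p)).

Definition multichain (f : {ffun 'I_n -> P}) : bool :=
  [forall i : 'I_n, forall j : 'I_n, (i <= j)%N ==> (f i <= f j)%O].

Definition letterplace (q : {mpoly k[nvars]}) : Prop :=
  exists c : {ffun 'I_n -> P} -> {mpoly k[nvars]},
    q = \sum_(f : {ffun 'I_n -> P} | multichain f)
          c f * \prod_(i < n) lvar i (f i).

(* The 0/1 exponent vector with support R. *)
Definition mdeg_set (R : {set 'I_n * P}) : 'X_{1..nvars} :=
  [multinom (enum_val j \in R : nat) | j < nvars].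

Definition layer (R : {set 'I_n * P}) (i : 'I_n) : {set P} :=
  [set p | (i, p) \in R].

(* R_1 <= ... <= R_n; the nonemptiness clause only matters for n = 1, where
   there are no consecutive pairs. *)
Definition layers_increasing (R : {set 'I_n * P}) : Prop :=
  (forall i : 'I_n, layer R i != set0) /\
  (forall i j : 'I_n, j = i.+1 :> nat -> set_le (layer R i) (layer R j)).

Definition layers_cover (R : {set 'I_n * P}) : Prop :=
  \bigcup_(i < n) layer R i = [set: P].

Definition layers_glue (R : {set 'I_n * P}) : Prop :=
  forall i j : 'I_n, j = i.+1 :> nat ->
    max_elts (layer R i) = min_elts (layer R j) /\
    maximal_antichain (max_elts (layer R i)).

End Letterplace.

(* Main.v *)
Require Import Defs.
From Stdlib Require Import Classical_Prop.
From mathcomp Require Import zify.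

(** A multigraded resolution of a monomial ideal I, augmented by S in the
    bottom degree, contains for every set U of variables a finite complex of
    vector spaces F_U: keep the basis elements whose degree divides the
    squarefree monomial x^U, and set all variables to 1.  This complex is exact
    when x^U lies in I, and otherwise its only homology is a line at the bottom.
    For W inside U put G(W, U) = F_U / sum_(w in W) F_(U - w).  As S sits
    in degree 0, the Betti number of I at R in degree i is the dimension of
    H_(i+1)(G(R, R)).  For W empty G(W, U) = F_U has known homology, and for v
    in U outside W there is an exact sequence
      0 -> G(W, U - v) -> G(W, U) -> G(W + v, U) -> 0
    ([connect], [connect_lift], [connect_bnd], [connect_onto], [bnd_retract]).
    Since G(W, U) computes the Betti number in degree W of the colon ideal
    I : x^(U - W), this sequence relates a variable to its deletion and to its
    contraction, and no other resolution than the given one ever appears.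

    For L(n, P) deletions and contractions can be organised so that only tail
    ideals occur: a function s on a subset A of P says at which layer a
    multichain may start, and the generators are the products
    x_(j,p_j) ... x_(n-1,p_(n-1)) with p_j <= ... <= p_(n-1) and j = s(q) for
    some q in A below p_j.  Let q be minimal in A and v = (s q, q); no other
    variable over q can occur in a minimal generator.  Deleting v therefore
    removes q from A, or, if W contains further variables over q, leaves a
    variable in no generator and kills all homology ([acyclic_cone]).
    Contracting v raises s to at least s q + 1 above q.

    By induction the homology vanishes above degree |A| ([acyclic_above]), and
    in degree |A| it is a line or zero.  If W has further variables over q, top
    homology is unchanged by contracting v.  If not, it is the kernel of
      H_(|A|-1)(deletion) -> H_(|A|-1)(contraction),
    both over A - q.  This map is injective as soon as its two ends are nonzero
    ([tight_inj]), so the top homology is a line exactly when the deletion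
    contributes and the contraction does not ([tight_homology]).  Unwinding
    the recursion, W must be a tight staircase: the variables over q fill an
    interval of layers from lo q to hi q, where lo q is the least value allowed
    by s and by the hi x with x < q, and hi q is the greatest value allowed by
    the lo y with y > q.

    For A = P and s = 0 these are exactly the sets R of the theorem
    ([tight_layersP]): lo q and hi q are the first and last layer containing q,
    and the common elements of two consecutive layers form a maximal antichain
    that separates what comes before from what comes after. *)

Set Implicit Arguments.
Unset Strict Implicit.
Unset Printing Implicit Defensive.

Import Order.TTheory GRing.Theory.
Local Open Scope ring_scope.

(** * Finite sets and posets *)

Lemma finset_induction (E : finType) (K : {set E} -> Prop) :
  K set0 -> (forall (W : {set E}) w, w \notin W -> K W -> K (w |: W)) -> forall W, K W.
Proof.
move=> K0 KS W; elim: {W}#|W| {-2}W (erefl #|W|) => [|m IH] W cW.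
  by rewrite (cards0_eq cW).
have /card_gt0P[w Ww] : (0 < #|W|)%N by rewrite cW.
rewrite -(setD1K Ww); apply: KS; first by rewrite !inE eqxx.
by apply: IH; move: cW; rewrite (cardsD1 w) Ww => -[].
Qed.

Lemma card_setD1 (T : finType) (B : {set T}) x : x \in B -> #|B| = #|B :\ x|.+1.
Proof. by move=> Bx; rewrite (cardsD1 x B) Bx. Qed.

Section Measure.

Variables (T T' : finType) (A : {set T}) (W : {set T'}) (m : nat).
Hypothesis le_m : (#|A| + #|W| <= m)%N.

Lemma measure_left x : x \in A -> (#|A :\ x| + #|W| < m)%N.
Proof. by move=> Ax; apply: leq_trans le_m; rewrite ltn_add2r [X in (_ < X)%N](cardsD1 x) Ax. Qed.

Lemma measure_right y : y \in W -> (#|A| + #|W :\ y| < m)%N.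
Proof. by move=> Wy; apply: leq_trans le_m; rewrite ltn_add2l [X in (_ < X)%N](cardsD1 y) Wy. Qed.

Lemma measure_both x y : x \in A -> y \in W -> (#|A :\ x| + #|W :\ y| < m)%N.
Proof.
move=> Ax /measure_right; apply: leq_ltn_trans.
by rewrite leq_add2r subset_leq_card // subD1set.
Qed.

End Measure.

Section FinitePosets.

Variables (disp : Order.disp_t) (P : finPOrderType disp).
Implicit Types (p q y : P) (A : {set P}).

Lemma exists_max_above {K : pred P} {p} : K p ->
  exists q, [/\ K q, (p <= q)%O & forall y, (q < y)%O -> ~~ K y].
Proof.
move=> Kp; have Kp' : K p && (p <= p)%O by rewrite Kp lexx.
case: (arg_maxnP (P := fun q => K q && (p <= q)%O)
         (fun q => #|[set x | (x <= q)%O]|) Kp') => q /andP[Kq pq] qmax.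
exists q; split=> // y qy; apply/negP => Ky.
have : (#|[set x | (x <= q)%O]| < #|[set x | (x <= y)%O]|)%N.
  apply/proper_card/properP; split.
    by apply/subsetP => x; rewrite !inE => /le_trans; apply; exact: ltW.
  by exists y; rewrite !inE ?lexx //; apply/negP => /(lt_le_trans qy); rewrite ltxx.
apply/negP; rewrite -leqNgt; apply: qmax.
by rewrite Ky (le_trans pq) // ltW.
Qed.

Lemma exists_min_below {K : pred P} {p} : K p ->
  exists q, [/\ K q, (q <= p)%O & forall y, (y < q)%O -> ~~ K y].
Proof.
move=> Kp; have Kp' : K p && (p <= p)%O by rewrite Kp lexx.
case: (arg_minnP (P := fun q => K q && (q <= p)%O)
         (fun q => #|[set x | (x <= q)%O]|) Kp') => q /andP[Kq qp] qmin.
exists q; split=> // y yq; apply/negP => Ky.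
have : (#|[set x | (x <= y)%O]| < #|[set x | (x <= q)%O]|)%N.
  apply/proper_card/properP; split.
    by apply/subsetP => x; rewrite !inE => /le_trans; apply; exact: ltW.
  by exists q; rewrite !inE ?lexx //; apply/negP => /(lt_le_trans yq); rewrite ltxx.
by rewrite ltnNge qmin // Ky (le_trans _ qp) // ltW.
Qed.

Lemma exists_minimal A : A != set0 ->
  exists2 q, q \in A & forall x, x \in A -> (x <= q)%O -> x = q.
Proof.
case/set0Pn => p Ap.
have [q [Aq _ qmin]] := exists_min_below (K := fun q => q \in A) Ap.
exists q => // x Ax; rewrite le_eqVlt => /orP[/eqP//|/qmin].
by rewrite Ax.
Qed.

End FinitePosets.

(** * Relative homology of a complex labelled by subsets *)

Section Supports.

Variable k : fieldType.

Definition supp_in m (p : pred 'I_m) (c : 'rV[k]_m) : Prop :=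
  forall j, c 0 j != 0 -> p j.

Lemma supp_in0 m (p : pred 'I_m) : supp_in p 0.
Proof. by move=> j; rewrite mxE eqxx. Qed.

Lemma supp_inD m (p : pred 'I_m) c c' :
  supp_in p c -> supp_in p c' -> supp_in p (c + c').
Proof.
move=> pc pc' j; rewrite mxE => nz.
have [c0|/pc//] := eqVneq (c 0 j) 0.
by apply: pc'; apply: contraNneq nz => c'0; rewrite c0 c'0 addr0.
Qed.

Lemma supp_inZ m (p : pred 'I_m) a c : supp_in p c -> supp_in p (a *: c).
Proof.
move=> pc j; rewrite mxE => nz; apply: pc.
by apply: contraNneq nz => ->; rewrite mulr0.
Qed.

Lemma supp_inN m (p : pred 'I_m) c : supp_in p c -> supp_in p (- c).
Proof. by rewrite -scaleN1r; exact: supp_inZ. Qed.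

Lemma supp_inB m (p : pred 'I_m) c c' :
  supp_in p c -> supp_in p c' -> supp_in p (c - c').
Proof. by move=> pc /supp_inN; exact: supp_inD. Qed.

Lemma supp_in_mul m m' (p : pred 'I_m) (p' : pred 'I_m') (M : 'M[k]_(m, m')) c :
  (forall a b, p a -> M a b != 0 -> p' b) -> supp_in p c -> supp_in p' (c *m M).
Proof.
move=> pM pc b; apply: contraR => np'; rewrite mxE big1 // => a _.
have [->|/pc pa] := eqVneq (c 0 a) 0; first by rewrite mul0r.
have [->|/(pM a b pa)] := eqVneq (M a b) 0; first by rewrite mulr0.
by rewrite (negbTE np').
Qed.

Definition cut m (p : pred 'I_m) (c : 'rV[k]_m) : 'rV[k]_m :=
  \row_j (if p j then c 0 j else 0).

Lemma cut_supp m (p : pred 'I_m) c : supp_in p (cut p c).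
Proof. by move=> j; rewrite mxE; case: ifP => //; rewrite eqxx. Qed.

Lemma cut_id m (p : pred 'I_m) c : supp_in p c -> cut p c = c.
Proof.
move=> pc; apply/rowP => j; rewrite mxE; case: ifPn => // npj.
by apply/esym/eqP; apply: contraR npj => /pc.
Qed.

Lemma cutB m (p : pred 'I_m) (c c' : 'rV[k]_m) :
  cut p (c - c') = cut p c - cut p c'.
Proof. by apply/rowP => j; rewrite !mxE; case: ifP; rewrite ?subrr. Qed.

End Supports.

(** A complex of vector spaces whose basis elements carry labels in the subsets
    of [E]; [within j U] says that the label of [j] is contained in [U], and may
    be false for every [U], as happens for basis elements of a degree that is
    not squarefree.  For each [U] the basis elements within [U] span a subcomplex
    which resolves [k] when [J U] fails and [0] when it holds: degree [0] stands
    for the polynomial ring, and [J] for the set of squarefree monomials of the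
    ideal. *)
Record set_resolution (k : fieldType) (E : finType) (J : {set E} -> Prop) :=
  SetResolution {
  crk : nat -> nat;
  bd : forall i, 'M[k]_(crk i.+1, crk i);
  within : forall i, 'I_(crk i) -> {set E} -> bool;
  gen : 'rV[k]_(crk 0);
  withinS : forall i (a : 'I_(crk i)) (U U' : {set E}),
    U \subset U' -> within a U -> within a U';
  withinI : forall i (a : 'I_(crk i)) (U U' : {set E}),
    within a U -> within a U' -> within a (U :&: U');
  within_bd : forall i (a : 'I_(crk i.+1)) (b : 'I_(crk i)) U,
    within a U -> bd i a b != 0 -> within b U;
  bd_bd : forall i, bd i.+1 *m bd i = 0;
  gen_neq0 : gen != 0;
  gen_within : forall U, supp_in (fun j => within j U) gen;
  gen_span : forall c, exists a, c = a *: gen;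
  bd_exact : forall i U (c : 'rV_(crk i.+1)),
    supp_in (fun j => within j U) c -> c *m bd i = 0 ->
    exists2 b : 'rV_(crk i.+2), supp_in (fun j => within j U) b & c = b *m bd i.+1;
  bd_onto : forall U, J U ->
    exists2 b : 'rV_(crk 1), supp_in (fun j => within j U) b & b *m bd 0 = gen;
  bd_zero : forall U (b : 'rV_(crk 1)),
    ~ J U -> supp_in (fun j => within j U) b -> b *m bd 0 = 0 }.

Section RelativeHomology.

Variables (k : fieldType) (E : finType) (J : {set E} -> Prop).
Variable C : set_resolution k J.
Implicit Types (U V W : {set E}) (v : E).

Definition chain i U : 'rV[k]_(crk C i) -> Prop := supp_in (fun j => within j U).

(** The basis elements of the subcomplex that is divided out of the chains on
    [U]: those which already lie over [U :\ w] for some [w] in [W].  Chains are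
    never passed to the quotient; cycles and boundaries are taken modulo [null]. *)
Definition partial i W U (j : 'I_(crk C i)) : bool :=
  [exists w in W, within j (U :\ w)].

Definition null i W U : 'rV[k]_(crk C i) -> Prop := supp_in (@partial i W U).

Definition cyc i W U : 'rV[k]_(crk C i) -> Prop :=
  match i with
  | 0 => @chain 0 U
  | i'.+1 => fun c => chain U c /\ null W U (c *m bd C i')
  end.

Definition bnd i W U (c : 'rV[k]_(crk C i)) : Prop :=
  exists2 b : 'rV_(crk C i.+1), chain U b & null W U (c - b *m bd C i).

Lemma chainS i U V (c : 'rV_(crk C i)) : U \subset V -> chain U c -> chain V c.
Proof. by move=> UV cU j /cU; exact: withinS. Qed.

Lemma chain_bd i U (c : 'rV_(crk C i.+1)) : chain U c -> chain U (c *m bd C i).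
Proof. by apply: supp_in_mul => a b; exact: within_bd. Qed.

Lemma partial_within i W U (j : 'I_(crk C i)) : partial W U j -> within j U.
Proof. by case/exists_inP => w _; apply: withinS; exact: subsetDl. Qed.

Lemma null_chain i W U (c : 'rV_(crk C i)) : null W U c -> chain U c.
Proof. by move=> cN j /cN; exact: partial_within. Qed.

Lemma null_bd i W U (c : 'rV_(crk C i.+1)) : null W U c -> null W U (c *m bd C i).
Proof.
apply: supp_in_mul => a b /exists_inP [w Ww aw] nz.
by apply/exists_inP; exists w => //; exact: within_bd nz.
Qed.

Lemma nullS i W W' U U' (c : 'rV_(crk C i)) :
  W \subset W' -> U \subset U' -> null W U c -> null W' U' c.
Proof.
move=> WW' UU' cN j /cN /exists_inP [w Ww jw]; apply/exists_inP.
by exists w; [exact: (subsetP WW') | exact: withinS (setSD _ UU') jw].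
Qed.

Lemma null_delete i W U v (c : 'rV_(crk C i)) :
  null W U c -> chain (U :\ v) c -> null W (U :\ v) c.
Proof.
move=> cN cU j nz; have /exists_inP [w Ww jw] := cN j nz.
apply/exists_inP; exists w => //; apply: withinS (withinI jw (cU j nz)).
by apply/subsetP => x; rewrite !inE => /andP[/andP[-> ->] /andP[-> _]].
Qed.

Lemma chain_null i W U v (c : 'rV_(crk C i)) :
  v \in W -> chain (U :\ v) c -> null W U c.
Proof. by move=> Wv cU j /cU jv; apply/exists_inP; exists v. Qed.

(** Dividing out one more vertex [v] only adds the chains over [U :\ v]; this
    makes the three relative complexes below into a short exact sequence. *)
Lemma null_split i W U v (c : 'rV_(crk C i)) : null (v |: W) U c ->
  exists2 e, chain (U :\ v) e & null W U (c - e).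
Proof.
move=> cN; exists (cut (fun j => within j (U :\ v)) c); first exact: cut_supp.
move=> j; rewrite !mxE; case: ifP => [_|nv]; first by rewrite subrr eqxx.
rewrite subr0 => /cN /exists_inP [w]; rewrite in_setU1 => /orP[/eqP->|Ww jw].
  by rewrite nv.
by apply/exists_inP; exists w.
Qed.

Lemma cyc_chain i W U (c : 'rV_(crk C i)) : cyc W U c -> chain U c.
Proof. by case: i c => [|i] c // []. Qed.

Lemma bnd0 i W U : bnd W U (0 : 'rV_(crk C i)).
Proof. by exists 0; [exact: supp_in0 | rewrite mul0mx subr0; exact: supp_in0]. Qed.

Lemma bndD i W U (c c' : 'rV_(crk C i)) :
  bnd W U c -> bnd W U c' -> bnd W U (c + c').
Proof.
move=> [b bU bc] [b' b'U b'c]; exists (b + b'); first exact: supp_inD.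
by rewrite mulmxDl opprD addrACA; exact: supp_inD.
Qed.

Lemma bndZ i W U a (c : 'rV_(crk C i)) : bnd W U c -> bnd W U (a *: c).
Proof.
move=> [b bU bc]; exists (a *: b); first exact: supp_inZ.
by rewrite -scalemxAl -scalerBr; exact: supp_inZ.
Qed.

Lemma bndB i W U (c c' : 'rV_(crk C i)) :
  bnd W U c -> bnd W U c' -> bnd W U (c - c').
Proof. by move=> bc /(bndZ (-1)); rewrite scaleN1r; exact: bndD. Qed.

Lemma null_bnd i W U (c : 'rV_(crk C i)) : null W U c -> bnd W U c.
Proof. by exists 0; [exact: supp_in0 | rewrite mul0mx subr0]. Qed.

Lemma cycD i W U (c c' : 'rV_(crk C i)) :
  cyc W U c -> cyc W U c' -> cyc W U (c + c').
Proof.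
case: i c c' => [|i] c c' /=; first exact: supp_inD.
by case=> cU cN [c'U c'N]; rewrite mulmxDl; split; exact: supp_inD.
Qed.

Lemma cycZ i W U a (c : 'rV_(crk C i)) : cyc W U c -> cyc W U (a *: c).
Proof.
case: i c => [|i] c /=; first exact: supp_inZ.
by case=> cU cN; rewrite -scalemxAl; split; exact: supp_inZ.
Qed.

Lemma cycB i W U (c c' : 'rV_(crk C i)) :
  cyc W U c -> cyc W U c' -> cyc W U (c - c').
Proof. by move=> cc /(cycZ (-1)); rewrite scaleN1r; exact: cycD. Qed.

Lemma cycS i W W' U U' (c : 'rV_(crk C i)) :
  W \subset W' -> U \subset U' -> cyc W U c -> cyc W' U' c.
Proof.
move=> WW' UU'; case: i c => [|i] c /=; first exact: chainS.
by case=> cU cN; split; [exact: chainS cU | exact: nullS cN].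
Qed.

Lemma bndS i W W' U U' (c : 'rV_(crk C i)) :
  W \subset W' -> U \subset U' -> bnd W U c -> bnd W' U' c.
Proof. by move=> WW' UU' [b bU bc]; exists b; [exact: chainS bU | exact: nullS bc]. Qed.

Lemma bnd_cyc i W U (c : 'rV_(crk C i)) : bnd W U c -> cyc W U c.
Proof.
case=> b bU bc; have cU : chain U c.
  by rewrite -[c](subrK (b *m bd C i)); apply: supp_inD (null_chain bc) (chain_bd bU).
case: i c b bU bc cU => [|i] c b bU bc cU //; split=> //.
have := null_bd bc; rewrite mulmxBl -mulmxA bd_bd mulmx0 subr0; exact.
Qed.

Section LongExact.

Variables (W U : {set E}) (v : E).

(** The connecting map sends the class of [c] to that of [e]. *)
Lemma connect i (c : 'rV_(crk C i.+1)) : cyc (v |: W) U c ->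
  exists2 e, cyc W (U :\ v) e & null W U (c *m bd C i - e).
Proof.
case=> cU /null_split [e eU eN]; exists e => //.
case: i c e cU eU eN => [|i] c e cU eU eN //; split=> //.
apply: null_delete (chain_bd eU).
rewrite -[X in null W U X]opprK; apply: supp_inN.
by have := null_bd eN; rewrite mulmxBl -mulmxA bd_bd mulmx0 sub0r.
Qed.

(** Exactness at the complex relative to [v |: W]: a class killed by the
    connecting map comes from the complex relative to [W]. *)
Lemma connect_lift i (c : 'rV_(crk C i.+1)) e :
  cyc (v |: W) U c -> null W U (c *m bd C i - e) -> bnd W (U :\ v) e ->
  exists2 c', cyc W U c' & bnd (v |: W) U (c - c').
Proof.
case=> cU cN eN [b bU be]; exists (c - b); last first.
  by rewrite opprB addrC subrK; apply/null_bnd/(chain_null (v := v)); rewrite ?setU11.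
have bU' : chain U b by apply: chainS bU; exact: subsetDl.
split; first exact: supp_inB.
rewrite mulmxBl -[c *m _](subrK e) -addrA; apply: supp_inD => //.
by apply: nullS be => //; exact: subsetDl.
Qed.

(** The connecting map is well defined on homology. *)
Lemma connect_bnd i (c : 'rV_(crk C i.+1)) e :
  cyc W (U :\ v) e -> null W U (c *m bd C i - e) -> bnd (v |: W) U c ->
  bnd W (U :\ v) e.
Proof.
move=> eZ eN [b bU] /null_split [e1 e1U nN]; exists e1 => //.
apply: null_delete; last exact: supp_inB (cyc_chain eZ) (chain_bd e1U).
have := supp_inB (null_bd nN) eN; rewrite !mulmxBl -mulmxA bd_bd mulmx0 subr0.
by rewrite opprB addrC addrA subrK.
Qed.

(** Exactness at the deletion: a class that dies in the middle complex is hit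
    by the connecting map. *)
Lemma connect_onto i (e : 'rV_(crk C i)) : cyc W (U :\ v) e -> bnd W U e ->
  exists2 c, cyc (v |: W) U c & null W U (c *m bd C i - e).
Proof.
move=> eZ [b bU be]; exists b; last by rewrite -opprB; exact: supp_inN.
split=> //; rewrite -[b *m _](subrK e).
apply: supp_inD; last by apply: (chain_null (v := v)) (cyc_chain eZ); rewrite setU11.
by rewrite -opprB; apply/supp_inN/(nullS _ _ be); rewrite ?subsetUr.
Qed.

(** Exactness in the middle: a class that dies relative to [v |: W] comes from
    the deletion of [v]. *)
Lemma bnd_retract i (c : 'rV_(crk C i)) : cyc W U c -> bnd (v |: W) U c ->
  exists2 c', cyc W (U :\ v) c' & bnd W U (c - c').
Proof.
move=> cZ [b bU] /null_split [e eU nN]; exists e.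
  case: i c b cZ bU e eU nN => [|i] c b cZ bU e eU nN //; split=> //.
  apply: null_delete (chain_bd eU).
  have := supp_inB cZ.2 (null_bd nN); rewrite !mulmxBl -mulmxA bd_bd mulmx0 subr0.
  by rewrite opprB addrC subrK.
by exists b; rewrite // addrAC.
Qed.

End LongExact.

Definition acyclic i W U : Prop := forall c : 'rV_(crk C i), cyc W U c -> bnd W U c.

(** One-dimensional homology, stated through representatives. *)
Definition homology_line i W U : Prop := exists z : 'rV_(crk C i),
  [/\ cyc W U z, ~ bnd W U z &
      forall c, cyc W U c -> exists a, bnd W U (c - a *: z)].

Definition homology_inj i W U U' : Prop := forall c : 'rV_(crk C i),
  cyc W U c -> bnd W U' c -> bnd W U c.

Lemma acyclic_step i W U v :
  acyclic i.+1 W U -> acyclic i W (U :\ v) -> acyclic i.+1 (v |: W) U.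
Proof.
move=> aW aWv c cZ; have [e eZ eN] := connect cZ.
have [c' c'Z cc'] := connect_lift cZ eN (aWv e eZ).
rewrite -[c](subrK c'); apply: bndD => //.
by apply: bndS (aW _ c'Z); rewrite ?subsetUr.
Qed.

Lemma acyclic_step0 W U v : acyclic 0 W U -> acyclic 0 (v |: W) U.
Proof. by move=> aW c /aW; apply: bndS; rewrite ?subsetUr. Qed.

Lemma acyclic_steps W U v : (forall i, acyclic i W U) ->
  (forall i, acyclic i W (U :\ v)) -> forall i, acyclic i (v |: W) U.
Proof. by move=> aW aWv [|i]; [exact: acyclic_step0 | exact: acyclic_step]. Qed.

End RelativeHomology.

Section Vanishing.

Variables (k : fieldType) (E : finType) (J : {set E} -> Prop).
Variable C : set_resolution k J.
Implicit Types (U V W X : {set E}) (v : E).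

Lemma null_set0 i U (c : 'rV_(crk C i)) : null set0 U c -> c = 0.
Proof.
move=> cN; apply/rowP => j; rewrite mxE; apply/eqP/negPn/negP => /cN.
by case/exists_inP => w; rewrite inE.
Qed.

Lemma acyclic_strand i U : acyclic C i.+1 set0 U.
Proof.
move=> c [cU /null_set0 c0]; have [b bU ->] := bd_exact cU c0.
by exists b; rewrite // subrr; exact: supp_in0.
Qed.

Lemma acyclic_strand0 U : J U -> acyclic C 0 set0 U.
Proof.
move=> JU c _; have [a ->] := gen_span c; apply: bndZ.
by have [b bU <-] := bd_onto C JU; exists b; rewrite // subrr; exact: supp_in0.
Qed.

(** This covers the unit ideal: when every set between [U :\: W] and [U] is in
    [J], all the complexes over single sets are exact, and the long exact
    sequences propagate this to the relative ones. *)
Lemma acyclic_full W U : (forall X, U :\: W \subset X -> X \subset U -> J X) ->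
  forall i, acyclic C i W U.
Proof.
elim/finset_induction: W U => [|W w wW IH] U JX.
  have JU : J U by apply: JX; rewrite ?setD0.
  by case=> [|i]; [exact: acyclic_strand0 | exact: acyclic_strand].
apply: acyclic_steps; apply: IH => X UX XU; apply: JX => //.
- by apply: subset_trans UX; apply: setDS; exact: subsetUr.
- by rewrite -setDDl.
- by apply: subset_trans XU _; exact: subsetDl.
Qed.

(** A variable occurring in no minimal generator cannot occur in a Betti
    degree.  For [W] empty, adding [v] does not change whether the set is in [J],
    so the two complexes over single sets have the same homology; adding further
    elements to [W] only combines acyclic complexes. *)
Lemma acyclic_cone W U v : v \in U -> v \notin W ->
    (forall X, U :\: (v |: W) \subset X -> X \subset U :\ v ->
       J (v |: X) -> J X) ->
  forall i, acyclic C i (v |: W) U.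
Proof.
elim/finset_induction: W U => [|W w wW IH] U vU vW JX.
  have JUv : J U -> J (U :\ v).
    by rewrite -{1}(setD1K vU); apply: JX; rewrite ?setU0.
  case=> [|[|i]].
  - move=> c _; apply/null_bnd/(chain_null (v := v)); first by rewrite setU11.
    by have [a ->] := gen_span c; apply/supp_inZ/gen_within.
  - have [JU|nJU] := classic (J U).
      apply: acyclic_step; first exact: acyclic_strand.
      exact: acyclic_strand0 (JUv JU).
    move=> c [cU _]; rewrite setU0.
    have [b bU ->] := bd_exact cU (bd_zero nJU cU).
    by exists b; rewrite // subrr; exact: supp_in0.
  - by apply: acyclic_step; exact: acyclic_strand.
move: vW; rewrite in_setU1 negb_or => /andP[vw vW].
rewrite setUCA; apply: acyclic_steps; apply: IH => //.
- move=> X UX XU; apply: JX => //; apply: subset_trans UX.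
  by apply: setDS; rewrite setUCA subsetUr.
- by rewrite !inE vw.
- move=> X UX XU; apply: JX.
    by rewrite setUCA -setDDl.
  by apply: subset_trans XU _; apply: setSD; exact: subsetDl.
Qed.

End Vanishing.

Section Transfer.

Variables (k : fieldType) (E : finType) (J : {set E} -> Prop).
Variable C : set_resolution k J.
Implicit Types (U V W X : {set E}) (v : E).

(** When the deletions have no homology, contraction of [v] is an isomorphism
    compatible with enlarging [U]. *)
Lemma inj_of_acyclic_delete i W U U' v : U \subset U' ->
  acyclic C i W (U :\ v) -> acyclic C i.+1 W (U' :\ v) ->
  homology_inj C i.+1 W U U' -> homology_inj C i.+1 (v |: W) U U'.
Proof.
move=> UU' aU aU' inj c cZ cB; have [e eZ eN] := connect cZ.
have [c' c'Z cc'] := connect_lift cZ eN (aU e eZ).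
rewrite -[c](subrK c'); apply: bndD => //; apply: bndS (inj _ c'Z _) => //.
  exact: subsetUr.
have c'B : bnd (v |: W) U' c'.
  by rewrite -[c'](subKr c); apply: bndB cB (bndS _ _ cc').
have [c2 /aU' c2B] := bnd_retract (cycS (subxx W) UU' c'Z) c'B.
rewrite -{2}[c'](subrK c2) => /bndD; apply; apply: bndS c2B => //.
exact: subsetDl.
Qed.

(** When the contraction has no homology, the connecting map embeds homology
    into that of the deletion, compatibly with enlarging [U]. *)
Lemma inj_of_acyclic_contract i W U U' v : U \subset U' ->
  acyclic C i.+1 W U -> homology_inj C i W (U :\ v) (U' :\ v) ->
  homology_inj C i.+1 (v |: W) U U'.
Proof.
move=> UU' aU inj c cZ cB; have [e eZ eN] := connect cZ.
have eB : bnd W (U :\ v) e.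
  apply: inj => //; apply: connect_bnd cB.
    by apply: cycS eZ => //; exact: setSD.
  exact: nullS eN.
have [c' c'Z cc'] := connect_lift cZ eN eB.
rewrite -[c](subrK c'); apply: bndD => //; apply: bndS (aU _ c'Z) => //.
exact: subsetUr.
Qed.

Lemma line_of_acyclic_delete i W U v :
  acyclic C i W (U :\ v) -> acyclic C i.+1 W (U :\ v) ->
  homology_line C i.+1 W U -> homology_line C i.+1 (v |: W) U.
Proof.
move=> a0 a1 [z [zZ znB zspan]]; exists z; split.
- by apply: cycS zZ => //; exact: subsetUr.
- move=> zB; apply: znB; have [c' /a1 c'B] := bnd_retract zZ zB.
  rewrite -{2}[z](subrK c') => /bndD; apply; apply: bndS c'B => //.
  exact: subsetDl.
move=> c cZ; have [e eZ eN] := connect cZ.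
have [c' c'Z cc'] := connect_lift cZ eN (a0 e eZ).
have [a c'B] := zspan _ c'Z; exists a.
rewrite -[c](subrK c') -addrA; apply: bndD => //.
by apply: bndS c'B => //; exact: subsetUr.
Qed.

(** If the contraction has no homology in the upper degree, homology is the
    kernel of the map from the deletion to the contraction one degree lower. *)
Lemma acyclic_of_inj i W U v : acyclic C i.+1 W U ->
  homology_inj C i W (U :\ v) U -> acyclic C i.+1 (v |: W) U.
Proof.
move=> aU inj c cZ; have [e eZ eN] := connect cZ.
have eB : bnd W (U :\ v) e.
  apply: inj => //; exists c; first exact: cyc_chain cZ.
  by rewrite -opprB; exact: supp_inN.
have [c' c'Z cc'] := connect_lift cZ eN eB.
rewrite -[c](subrK c'); apply: bndD => //; apply: bndS (aU _ c'Z) => //.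
exact: subsetUr.
Qed.

(** The opposite extreme: if the contraction has no homology in the lower degree
    either, that kernel is the whole homology of the deletion. *)
Lemma line_of_acyclic_contract i W U v :
  acyclic C i.+1 W U -> acyclic C i W U -> homology_line C i W (U :\ v) ->
  homology_line C i.+1 (v |: W) U.
Proof.
move=> a1 a0 [z0 [z0Z z0nB z0span]].
have z0B : bnd W U z0 by apply: a0; apply: cycS z0Z => //; exact: subsetDl.
have [z zZ zN] := connect_onto z0Z z0B.
exists z; split=> // [zB|c cZ]; first exact: z0nB (connect_bnd z0Z zN zB).
have [e eZ eN] := connect cZ; have [a eB] := z0span _ eZ; exists a.
have dZ : cyc (v |: W) U (c - a *: z) by apply: cycB cZ (cycZ _ zZ).
have dN : null W U ((c - a *: z) *m bd C i - (e - a *: z0)).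
  rewrite mulmxBl -scalemxAl opprB [a *: z0 - e]addrC addrACA.
  rewrite [- (a *: _) + _]addrC -[a *: z0 - _]opprB -scalerBr.
  by apply: supp_inB => //; exact: supp_inZ.
have [c' c'Z cc'] := connect_lift dZ dN eB.
rewrite -[_ - _](subrK c'); apply: bndD => //; apply: bndS (a1 _ c'Z) => //.
exact: subsetUr.
Qed.

End Transfer.

(** * Tail ideals of a poset *)

Section TailIdeals.

Variables (disp : Order.disp_t) (P : finPOrderType disp) (n : nat).
Implicit Types (A : {set P}) (s : P -> nat) (X W U : {set 'I_n * P}) (q : P).

(** [X] contains the support of a generator: a multichain running from layer
    [s q] to the last one and lying above [q].  When [s q >= n] the multichain is empty and the ideal
    is the unit ideal, so that contraction never leaves this family. *)
Definition tail_ideal A s X : Prop :=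
  exists2 q, q \in A & exists f : nat -> P,
    [/\ {homo f : i j / (i <= j)%N >-> (i <= j)%O}, (q <= f 0%N)%O &
        forall l : 'I_n, (s q <= l)%N -> (l, f l) \in X].

Definition raise s (j : nat) q : P -> nat :=
  fun x => if (q <= x)%O then maxn (s x) j.+1 else s x.

Lemma raise_ge s j q x : (s x <= raise s j q x)%N.
Proof. by rewrite /raise; case: ifP => // _; exact: leq_maxl. Qed.

Lemma raise_homo s j q : {homo s : x y / (x <= y)%O >-> (x <= y)%N} ->
  {homo raise s j q : x y / (x <= y)%O >-> (x <= y)%N}.
Proof.
move=> sh x y xy; rewrite /raise; have := sh x y xy.
case: ifP => [qx|_]; first by rewrite (le_trans qx xy); lia.
by case: ifP => _; lia.
Qed.

Lemma raise_same s j q : s q = j -> raise s j q q = j.+1.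
Proof. by move=> <-; rewrite /raise lexx; lia. Qed.

Section MinimalElement.

Variables (A : {set P}) (s : P -> nat) (q : P).
Hypothesis s_homo : {homo s : x y / (x <= y)%O >-> (x <= y)%N}.
Hypothesis Aq : q \in A.
Hypothesis q_min : forall x, x \in A -> (x <= q)%O -> x = q.

Lemma tail_ideal_unit X : (n <= s q)%N -> tail_ideal A s X.
Proof.
move=> ns; exists q => //; exists (fun=> q); split=> // l sl.
by have := ltn_ord l; lia.
Qed.

(** A multichain passing through [q] lies above an element of [A] below [q], hence
    starts at [q]; being squeezed below [q], it uses the variable [(s q, q)]. *)
Lemma tail_ideal_cone (j : 'I_n) w X : s q = j -> (j, q) \notin w |: X ->
  w.2 = q -> tail_ideal A s (w |: X) -> tail_ideal A s X.
Proof.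
case: w => l r sj jX /= rq; rewrite {r}rq in jX *.
case=> q0 Aq0 [f [fh qf fX]]; exists q0 => //; exists f; split=> // m sm.
have := fX m sm; rewrite in_setU1 => /orP[/eqP[ml fm]|//].
have q0q : q0 = q.
  by apply: q_min => //; rewrite -fm; apply: le_trans qf _; exact: fh.
rewrite q0q in sm qf fX; rewrite sj in sm fX.
have fj : f j = q.
  by apply/le_anti; rewrite -{1}fm fh // (le_trans qf) // fh.
by have := fX j (leqnn j); rewrite fj (negbTE jX).
Qed.

(** A multichain starting at [q] but avoiding the variables over [q] passes at layer
    [s q] through a larger element, from which it may start as well, only later. *)
Lemma tail_ideal_drop X : (s q < n)%N -> (forall w, w \in X -> w.2 \in A :\ q) ->
  tail_ideal A s X -> tail_ideal (A :\ q) s X.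
Proof.
move=> sqn XA [q0 Aq0 [f [fh qf fX]]].
(* Only multichains starting at [q] need a new starting point. *)
have [q0q|nq] := eqVneq q0 q; last by exists q0; rewrite ?inE ?nq //; exists f.
rewrite q0q in qf fX.
pose j := Ordinal sqn; have fj := XA _ (fX j (leqnn _)).
exists (f j) => {Aq0 q0q q0}; first exact: fj.
(* Freezing [f] before layer [j] makes it lie above the new start [f j]. *)
exists (fun l => f (maxn j l)); split.
- by move=> x y xy; apply: fh; rewrite geq_max !leq_max leqnn xy orbT.
- by rewrite maxn0.
move=> l sl; have jl : (j <= l)%N.
  apply: leq_trans sl; apply: (@s_homo q); apply: le_trans qf _; exact: fh.
by rewrite (maxn_idPr jl); exact: fX.
Qed.

(** Dividing by the variable [(s q, q)] frees the elements above [q] to start one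
    layer later than [q] does. *)
Lemma tail_ideal_contract (j : 'I_n) X : s q = j -> (j, q) \notin X ->
  tail_ideal A s ((j, q) |: X) <-> tail_ideal A (raise s j q) X.
Proof.
move=> sj jX; split=> -[q0 Aq0 [f [fh qf fX]]].
  exists q0 => //; exists f; split=> // l sl.
  have := fX l (leq_trans (raise_ge s j q q0) sl).
  rewrite in_setU1 => /orP[/eqP[lj fl]|//].
  have q0q : q0 = q.
    by apply: q_min => //; rewrite -fl; apply: le_trans qf _; exact: fh.
  by move: sl; rewrite q0q raise_same // lj ltnn.
have [qq0|nqq0] := boolP (q <= q0)%O; last first.
  exists q0 => //; exists f; split=> // l sl; rewrite in_setU1 fX ?orbT //.
  by rewrite /raise (negbTE nqq0).
have sq0 : (j <= s q0)%N by rewrite -sj; exact: s_homo.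
have bq0 : raise s j q q0 = maxn (s q0) j.+1 by rewrite /raise qq0.
have [js|] := ltnP j (s q0).
  by exists q0 => //; exists f; split=> // l sl; rewrite in_setU1 fX ?orbT //; lia.
(* Here [q0] starts in layer [j] too, and its multichain is prolonged by [q]. *)
move=> sj'; exists q => //; exists (fun l => if (l <= j)%N then q else f l).
split=> //.
- move=> x y xy; case: (leqP x j) (leqP y j) => [xj|jx] [yj|jy] //.
  + by apply: le_trans qq0 (le_trans qf _); exact: fh.
  + by lia.
  + exact: fh.
move=> l; rewrite sj leq_eqVlt => /orP[/eqP jl|jl].
  by rewrite -jl leqnn (_ : l = j) ?setU11 //; apply/val_inj.
by rewrite leqNgt jl /= in_setU1 fX ?orbT //; lia.
Qed.

End MinimalElement.

End TailIdeals.

(** * Tight staircases *)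

Section Staircases.

Variables (disp : Order.disp_t) (P : finPOrderType disp) (n : nat).
Implicit Types (A : {set P}) (s lo hi : P -> nat) (W : {set 'I_n * P}) (q : P).

(** The elements of [W] over [q] fill the layers from [lo q] to [hi q], and the
    intervals of comparable elements abut as closely as [s] and [n] permit. *)
Definition staircase A s W lo hi : Prop :=
  [/\ forall q, q \in A -> [/\ (s q <= lo q)%N, (lo q <= hi q)%N & (hi q < n)%N],
      forall q (l : 'I_n), q \in A -> ((l, q) \in W) = (lo q <= l <= hi q)%N,
      forall x q, x \in A -> q \in A -> (x < q)%O -> (hi x <= lo q)%N,
      forall q, q \in A ->
        lo q = s q \/ exists x, [/\ x \in A, (x < q)%O & hi x = lo q] &
      forall q, q \in A ->
        hi q = n.-1 \/ exists y, [/\ y \in A, (q < y)%O & lo y = hi q]].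

Definition tight A s W : Prop := exists lo hi, staircase A s W lo hi.

Section MinimalElement.

Variables (A : {set P}) (s : P -> nat) (W : {set 'I_n * P}) (q : P).
Hypothesis s_homo : {homo s : x y / (x <= y)%O >-> (x <= y)%N}.
Hypothesis Aq : q \in A.
Hypothesis q_min : forall x, x \in A -> (x <= q)%O -> x = q.

Lemma no_below x : x \in A -> ~~ (x < q)%O.
Proof. by move=> Ax; apply/negP => xq; have := q_min Ax (ltW xq); move: xq => /[swap] ->; rewrite ltxx. Qed.

Lemma staircase_lo lo hi : staircase A s W lo hi -> lo q = s q.
Proof.
case=> _ _ _ /(_ q Aq) + _; case=> // -[x [Ax xq _]].
by rewrite (negbTE (no_below Ax)) in xq.
Qed.

Lemma tight_start : tight A s W -> exists2 j : 'I_n, s q = j & (j, q) \in W.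
Proof.
case=> lo [hi st]; have loq := staircase_lo st.
case: st => bnds cols _ _ _; have [slo lohi hin] := bnds q Aq.
have sn : (s q < n)%N by lia.
by exists (Ordinal sn); rewrite // cols //= loq leqnn -loq.
Qed.

Lemma tight_ge (l : 'I_n) : tight A s W -> (l, q) \in W -> (s q <= l)%N.
Proof.
case=> lo [hi st]; have loq := staircase_lo st.
by case: st => _ cols _ _ _; rewrite cols // loq => /andP[].
Qed.

Variable j : 'I_n.
Hypothesis sj : s q = j.
Hypothesis Wj : (j, q) \in W.

Lemma raise_other x : ~~ (q < x)%O -> x != q -> raise s j q x = s x.
Proof. by rewrite /raise lt_def => + nx; rewrite nx /= => /negbTE ->. Qed.

Lemma raise_above x : (q < x)%O -> raise s j q x = maxn (s x) j.+1.
Proof. by rewrite /raise => /ltW ->. Qed.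

Let inWD x (l : 'I_n) : x != q -> ((l, x) \in W :\ (j, q)) = ((l, x) \in W).
Proof. by move=> nx; rewrite !inE xpair_eqE (negbTE nx) andbF. Qed.

(** While the interval over [q] has length at least two, removing its lowest
    layer and raising [s] accordingly changes only the value [lo q]. *)
Lemma tight_contract : (exists2 w, w \in W :\ (j, q) & w.2 = q) ->
  tight A s W <-> tight A (raise s j q) (W :\ (j, q)).
Proof.
case=> -[l r] + /= rq; rewrite {r}rq !inE xpair_eqE eqxx andbT => /andP[lj Wl].
have {}lj : l <> j :> nat by move/val_inj/eqP; rewrite (negbTE lj).
split=> -[lo [hi st]].
  have loq := staircase_lo st; case: st => bnds cols ord low high.
  have hiq : (j < hi q)%N.
    by move: Wl; rewrite cols // loq sj => /andP[]; lia.
  exists (fun x => if x == q then j.+1 else lo x), hi; split.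
  - move=> x Ax; have [b1 b2 b3] := bnds x Ax.
    have [->|nx] := eqVneq x q; first by rewrite raise_same //; have [] := bnds q Aq.
    split=> //; have [qx|nqx] := boolP (q < x)%O; last by rewrite raise_other.
    by rewrite raise_above //; have := ord q x Aq Ax qx; lia.
  - move=> x m Ax; have [->|nx] := eqVneq x q; last by rewrite inWD // cols.
    rewrite !inE xpair_eqE eqxx andbT cols // loq sj -val_eqE /=.
    by rewrite ltn_neqAle eq_sym andbA.
  - move=> x y Ax Ay xy; have [yq|ny] := eqVneq y q; last exact: ord.
    by move: xy; rewrite yq (negbTE (no_below Ax)).
  - move=> x Ax; have [->|nx] := eqVneq x q; first by left; rewrite raise_same.
    have [lox|lox] := low x Ax; last by right.
    left; have [qx|nqx] := boolP (q < x)%O; last by rewrite raise_other.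
    by rewrite raise_above //; have := ord q x Aq Ax qx; lia.
  - move=> x Ax; have [hix|[y [Ay xy hiy]]] := high x Ax; [by left|right].
    exists y; split=> //; case: eqP => // yq.
    by move: xy; rewrite yq (negbTE (no_below Ax)).
case: st => bnds cols ord low high.
have loq : lo q = j.+1.
  have [|[x [Ax xq _]]] := low q Aq; first by rewrite raise_same.
  by rewrite (negbTE (no_below Ax)) in xq.
exists (fun x => if x == q then nat_of_ord j else lo x), hi; split.
- move=> x Ax; have [b1 b2 b3] := bnds x Ax.
  have [xq|nx] := eqVneq x q; first by rewrite xq loq in b2 b3 *; rewrite sj; split=> //; exact: ltnW.
  by split=> //; apply: leq_trans (raise_ge _ _ _ _) b1.
- move=> x m Ax; have [->|nx] := eqVneq x q; last by rewrite -inWD // cols.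
  have [mj|mj] := eqVneq m j.
    by have [b1 b2 b3] := bnds q Aq; rewrite mj Wj leqnn /=; lia.
  have := cols q m Aq; rewrite !inE xpair_eqE eqxx andbT mj /= => ->.
  rewrite loq [RHS]andbC [LHS]andbC; congr (_ && _).
  by rewrite [RHS]leq_eqVlt eq_sym val_eqE (negbTE mj).
- move=> x y Ax Ay xy; have [yq|ny] := eqVneq y q; last exact: ord.
  by move: xy; rewrite yq (negbTE (no_below Ax)).
- move=> x Ax; have [->|nx] := eqVneq x q; first by left.
  have [lox|lox] := low x Ax; last by right.
  have [qx|nqx] := boolP (q < x)%O; last by left; rewrite lox raise_other.
  have [js|] := ltnP j (s x); first by left; rewrite lox raise_above //; lia.
  move=> sxj; right; exists q; split=> //.
  have := ord q x Aq Ax qx; have [_ + _] := bnds q Aq.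
  by move: lox; rewrite raise_above //; lia.
- move=> x Ax; have [hix|[y [Ay xy hiy]]] := high x Ax; [by left|right].
  exists y; split=> //; case: eqP => // yq.
  by move: xy; rewrite yq (negbTE (no_below Ax)).
Qed.

Section ShortColumn.

Hypothesis short : forall w, w \in W :\ (j, q) -> w.2 != q.

Let AD x : x \in A :\ q -> x \in A /\ x != q.
Proof. by rewrite !inE => /andP[]. Qed.

Let short_hi lo hi : staircase A s W lo hi -> hi q = j.
Proof.
move=> st; have loq := staircase_lo st; case: st => bnds cols ord low high.
have [_ lohi hin] := bnds q Aq.
have : (Ordinal hin, q) \in W by rewrite cols //= lohi leqnn.
have [<-//|nj] := eqVneq (Ordinal hin) j => WH.
by have := short (w := (Ordinal hin, q)); rewrite !inE xpair_eqE (negbTE nj) eqxx => /(_ WH).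
Qed.

Lemma tight_drop : tight A s W -> tight (A :\ q) s (W :\ (j, q)).
Proof.
case=> lo [hi st]; have loq := staircase_lo st; have hiq := short_hi st.
case: st => bnds cols ord low high; exists lo, hi; split.
- by move=> x /AD[Ax _]; exact: bnds.
- by move=> x m /AD[Ax nx]; rewrite inWD // cols.
- by move=> x y /AD[Ax _] /AD[Ay _]; exact: ord.
- move=> x /AD[Ax nx]; have [|[y [Ay yx hiy]]] := low x Ax; first by left.
  have [yq|ny] := eqVneq y q; last by right; exists y; rewrite !inE ny.
  left; have [+ _ _] := bnds x Ax; have := s_homo (ltW yx).
  by rewrite -hiy yq hiq sj; lia.
- move=> x /AD[Ax nx]; have [|[y [Ay xy loy]]] := high x Ax; first by left.
  right; exists y; split=> //; rewrite !inE Ay andbT.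
  by apply: contraTneq xy => ->; exact: no_below.
Qed.

(** Tightness at [q] asks for a [y] above [q] whose interval starts in layer [j],
    which the raised function [s] forbids. *)
Lemma tight_contract_drop : (j.+1 < n)%N ->
  tight (A :\ q) (raise s j q) (W :\ (j, q)) -> ~ tight A s W.
Proof.
move=> jn [lo' [hi' st']] [lo [hi st]]; have hiq := short_hi st.
case: st => bnds cols ord low high.
have [|[y [Ay qy loy]]] := high q Aq; first by lia.
have ny : y != q by apply: contraTneq qy => ->; rewrite ltxx.
have [b1 b2 b3] := bnds y Ay.
have : (j, y) \in W :\ (j, q) by rewrite inWD // cols // loy hiq leqnn /=; lia.
have Ay' : y \in A :\ q by rewrite !inE ny.
case: st' => bnds' cols' _ _ _; rewrite cols' // => /andP[lj _].
by have [+ _ _] := bnds' y Ay'; rewrite raise_above //; lia.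
Qed.

(** If no [y] above [q] started in layer [j], raising [s] would preserve the
    staircase over [A :\ q]; so either such a [y] exists or [j] is the last
    layer, and in both cases the interval over [q] reduced to [j] is tight. *)
Lemma tight_undrop : tight (A :\ q) s (W :\ (j, q)) ->
  ~ tight (A :\ q) (raise s j q) (W :\ (j, q)) \/ j.+1 = n -> tight A s W.
Proof.
case=> lo [hi [bnds cols ord low high]] alt.
have DA x : x \in A -> x != q -> x \in A :\ q by move=> Ax nx; rewrite !inE nx.
pose lo' x := if x == q then nat_of_ord j else lo x.
pose hi' x := if x == q then nat_of_ord j else hi x.
exists lo', hi'; rewrite /lo' /hi'; split.
- move=> x Ax; have [->|nx] := eqVneq x q; last exact: bnds (DA _ _ nx).
  by rewrite sj; split; last exact: ltn_ord j.
- move=> x m Ax; have [->|nx] := eqVneq x q; last by rewrite -inWD // cols // DA.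
  rewrite -eqn_leq; have [mj|mj] := eqVneq m j; first by rewrite mj Wj eqxx.
  rewrite eq_sym val_eqE (negbTE mj); apply/negP => Wm.
  by have := short (w := (m, q)); rewrite !inE xpair_eqE (negbTE mj) eqxx => /(_ Wm).
- move=> x y Ax Ay xy; have [yq|ny] := eqVneq y q.
    by move: xy; rewrite yq (negbTE (no_below Ax)).
  have [xq|nx] := eqVneq x q; last exact: ord (DA _ _ nx) (DA _ _ ny) xy.
  have [+ _ _] := bnds y (DA _ Ay ny); apply: leq_trans.
  by rewrite -sj -xq; apply/s_homo/ltW.
- move=> x Ax; have [->|nx] := eqVneq x q; first by left.
  have [lox|[y [/AD[Ay ny] yx hiy]]] := low x (DA _ Ax nx); first by left.
  by right; exists y; rewrite (negbTE ny).
move=> x Ax; have [xq|nx] := eqVneq x q; last first.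
  have [hix|[y [/AD[Ay ny] xy loy]]] := high x (DA _ Ax nx); first by left.
  by right; exists y; rewrite (negbTE ny).
case: alt => [nt|jn]; last by left; rewrite -[X in X.-1]jn.
right; apply: NNPP => no; apply: nt.
have loy y : y \in A :\ q -> (q < y)%O -> (j < lo y)%N.
  move=> Ay qy; have [Ay' ny] := AD Ay; have [b1 _ _] := bnds y Ay.
  have := s_homo (ltW qy); rewrite sj => jy.
  suff : lo y <> j by move=> ?; lia.
  by move=> ly; case: no; exists y; rewrite xq (negbTE ny).
exists lo, hi; split=> //.
- move=> y Ay; have [b1 b2 b3] := bnds y Ay; split=> //.
  have [qy|nqy] := boolP (q < y)%O; last by rewrite raise_other; have [] := AD Ay.
  by rewrite raise_above //; have := loy y Ay qy; lia.
- move=> y Ay; have [ly|ly] := low y Ay; last by right.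
  left; have [qy|nqy] := boolP (q < y)%O; last by rewrite raise_other; have [] := AD Ay.
  by rewrite raise_above //; have := loy y Ay qy; lia.
Qed.

End ShortColumn.

End MinimalElement.

End Staircases.

(** * Top homology of tail ideals *)

Section Peeling.

Variables (disp : Order.disp_t) (P : finPOrderType disp) (n : nat).
Variables (k : fieldType) (J : {set 'I_n * P} -> Prop).
Variable C : set_resolution k J.
Implicit Types (A : {set P}) (s : P -> nat) (W U X : {set 'I_n * P}) (q : P).

(** [J] contracted along [U :\: W] and restricted to [W] is the tail ideal of
    [A] and [s]. *)
Record presents A s W U : Prop := Presents {
  presents_sub : W \subset U;
  presents_col : forall w, w \in W -> w.2 \in A;
  presents_homo : {homo s : x y / (x <= y)%O >-> (x <= y)%N};
  presents_mem : forall X, U :\: W \subset X -> X \subset U ->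
    J X <-> tail_ideal A s (X :&: W) }.

Lemma presents_delete A s W U v : v \in W -> presents A s W U ->
  presents A s (W :\ v) (U :\ v).
Proof.
move=> Wv [WU col sh mem]; split=> //; first exact: setSD.
  by move=> w; rewrite inE => /andP[_]; exact: col.
move=> X UX XU; have vX : v \notin X by apply/negP => /(subsetP XU); rewrite !inE eqxx.
have -> : X :&: (W :\ v) = X :&: W.
  by apply/setP => x; rewrite !inE; case: eqP => // ->; rewrite (negbTE vX).
apply: mem; last by apply: subset_trans XU _; exact: subsetDl.
apply: subset_trans UX; apply/subsetP => x; rewrite !inE.
by case: eqP => [->|_]; rewrite ?Wv.
Qed.

Lemma presents_drop A s W U q : (s q < n)%N ->
  (forall w, w \in W -> w.2 != q) -> presents A s W U -> presents (A :\ q) s W U.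
Proof.
move=> sqn Wq [WU col sh mem]; split=> // [w Ww|X UX XU].
  by rewrite !inE Wq // col.
rewrite mem //; split; last first.
  by case=> r; rewrite inE => /andP[_ Ar] [f fP]; exists r => //; exists f.
apply: tail_ideal_drop => // w; rewrite inE => /andP[_ Ww].
by rewrite !inE Wq // col.
Qed.

Lemma presents_unit A s W U q : q \in A -> (n <= s q)%N -> presents A s W U ->
  forall i, acyclic C i W U.
Proof.
move=> Aq nq [WU col sh mem]; apply: acyclic_full => X UX XU.
by apply/mem => //; exact: tail_ideal_unit nq.
Qed.

Section MinimalElement.

Variables (A : {set P}) (s : P -> nat) (q : P).
Hypothesis Aq : q \in A.
Hypothesis q_min : forall x, x \in A -> (x <= q)%O -> x = q.

Lemma presents_contract W U (j : 'I_n) : presents A s W U -> s q = j -> (j, q) \in W ->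
  presents A (raise s j q) (W :\ (j, q)) U.
Proof.
case=> WU col sh mem sj Wj; split.
- by apply: subset_trans WU; exact: subsetDl.
- by move=> w; rewrite inE => /andP[_]; exact: col.
- exact: raise_homo.
move=> X UX XU; have Xj : (j, q) \in X.
  by apply: (subsetP UX); rewrite !inE eqxx (subsetP WU).
rewrite mem //; last by apply: subset_trans UX; apply: setDS; exact: subsetDl.
have -> : X :&: W = (j, q) |: (X :&: (W :\ (j, q))).
  by apply/setP => x; rewrite !inE; case: eqP => // ->; rewrite Xj Wj.
by apply: tail_ideal_contract => //; rewrite !inE eqxx andbF.
Qed.

Lemma presents_cone W U (j : 'I_n) w : presents A s W U -> s q = j -> (j, q) \notin W ->
  w \in W -> w.2 = q -> forall i, acyclic C i W U.
Proof.
case=> WU col sh mem sj Wj Ww wq; rewrite -(setD1K Ww).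
have Uw : w \in U by exact: (subsetP WU).
apply: acyclic_cone => //; first by rewrite !inE eqxx.
move=> X; rewrite setD1K // => UX XU.
have XU' : X \subset U by apply: subset_trans XU _; exact: subsetDl.
rewrite !mem //; last first.
- by rewrite subUset sub1set Uw.
- by apply: subset_trans UX _; exact: subsetUr.
have -> : (w |: X) :&: W = w |: (X :&: W).
  by rewrite setIUl; congr (_ :|: _); apply/setIidPl; rewrite sub1set.
apply: tail_ideal_cone sj _ wq => //.
by apply: contra Wj; rewrite !inE => /orP[/eqP->|/andP[]].
Qed.

(** The fate of the minimal element [q]: either all homology vanishes, or [q] can
    be removed from [A], or [(s q, q)] lies in [W], and then what matters is
    whether [W] contains other variables over [q]. *)
Variant peel_spec W U : Prop :=
| PeelAcyclic of (forall i, acyclic C i W U) & ~ tight A s W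
| PeelDrop of presents (A :\ q) s W U & ~ tight A s W
| PeelLong (j : 'I_n) of s q = j & (j, q) \in W &
    (exists2 w, w \in W :\ (j, q) & w.2 = q) &
    (forall i, acyclic C i (W :\ (j, q)) (U :\ (j, q))) &
    presents A (raise s j q) (W :\ (j, q)) U
| PeelShort (j : 'I_n) of s q = j & (j, q) \in W &
    (forall w, w \in W :\ (j, q) -> w.2 != q) &
    presents (A :\ q) s (W :\ (j, q)) (U :\ (j, q)) &
    presents A (raise s j q) (W :\ (j, q)) U.

Lemma peelP W U : presents A s W U -> peel_spec W U.
Proof.
move=> pres.
have start := tight_start (W := W) (s := s) Aq q_min.
have [ns|sn] := leqP n (s q).
  apply: PeelAcyclic; first exact: presents_unit Aq ns pres.
  by case/start => j sj _; have := ltn_ord j; lia.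
pose j := Ordinal sn; have sj : s q = j by [].
have [Wj|Wj] := boolP ((j, q) \in W); last first.
  have nt : ~ tight A s W.
    case/start => j' sj' Wj'; move: Wj; rewrite (_ : j = j') ?Wj' //.
    exact/val_inj.
  have [/exists_inP[w Ww /eqP wq]|none] := boolP [exists w in W, w.2 == q].
    by apply: PeelAcyclic nt; exact: presents_cone pres sj Wj Ww wq.
  apply: PeelDrop nt; apply: presents_drop => // w Ww.
  by apply: contra none => wq; apply/exists_inP; exists w.
have presD := presents_delete Wj pres.
have jWD : (j, q) \notin W :\ (j, q) by rewrite !inE eqxx.
have presB := presents_contract pres sj Wj.
have [/exists_inP[w Ww /eqP wq]|none] := boolP [exists w in W :\ (j, q), w.2 == q].
  apply: PeelLong presB => //; first by exists w.
  exact: presents_cone presD sj jWD Ww wq.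
have Wq w : w \in W :\ (j, q) -> w.2 != q.
  by move=> Ww; apply: contra none => wq; apply/exists_inP; exists w.
by apply: PeelShort presB => //; exact: presents_drop.
Qed.

End MinimalElement.

Lemma presents_empty s W U : presents set0 s W U -> W = set0 /\ ~ J U.
Proof.
case=> _ col _ mem; have W0 : W = set0.
  by apply/setP => w; rewrite inE; apply/negP => /col; rewrite inE.
by split=> // /mem; rewrite W0 setD0 => -[] // q; rewrite inE.
Qed.

(** The quotient by a tail ideal on [A] behaves as if it had projective dimension
    at most [#|A|]: each removal of a minimal element costs one degree. *)
Theorem acyclic_above A s W U i : presents A s W U -> (#|A| < i)%N ->
  acyclic C i W U.
Proof.
have [m] := ubnP (#|A| + #|W|)%N.
elim: m A s W U i => // m IH A s W U i; rewrite ltnS => Am pres Ai.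
have [A0|/exists_minimal[q Aq q_min]] := eqVneq A set0.
  move: pres; rewrite A0 => /presents_empty[-> _].
  by case: i Ai => // i _; exact: acyclic_strand.
have cA := card_setD1 Aq.
case: (peelP Aq q_min pres) => [acyc _|pD _|j sj Wj _ acD pB|j sj Wj Wq pD pB].
- exact: acyc.
- by apply: IH pD _; [exact: measure_left | lia].
- case: i Ai => // i Ai; rewrite -(setD1K Wj); apply: acyclic_step => //.
  by apply: IH pB Ai; exact: measure_right.
case: i Ai => // i Ai; rewrite -(setD1K Wj); apply: acyclic_step.
  by apply: IH pB Ai; exact: measure_right.
by apply: IH pD _; [exact: measure_both | rewrite -ltnS -cA].
Qed.

(** After contraction nothing is left over [q], so the bound improves by one. *)
Lemma acyclic_above_short A s W U q (j : 'I_n) i : q \in A -> s q = j ->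
  (forall w, w \in W -> w.2 != q) -> presents A (raise s j q) W U ->
  (#|A :\ q| < i)%N -> acyclic C i W U.
Proof.
move=> Aq sj Wq pB; have [nj|jn] := leqP n j.+1.
  by move=> _; apply: (presents_unit Aq _ pB); rewrite raise_same.
by apply: acyclic_above; apply: presents_drop pB => //; rewrite raise_same.
Qed.

(** Enlarging a tail ideal does not kill top homology as long as both ends are
    nonzero.  Peeling [q] off both sides at once reduces the comparison of the
    ideals to that of their contractions, or of their deletions; it is used with
    the enlargement from a deletion to the contraction. *)
Theorem tight_inj A s s2 W U U2 : presents A s W U -> presents A s2 W U2 ->
  U \subset U2 -> (forall x, s x <= s2 x)%N -> tight A s W -> tight A s2 W ->
  homology_inj C #|A| W U U2.
Proof.
have [m] := ubnP (#|A| + #|W|)%N.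
elim: m A s s2 W U U2 => // m IH A s s2 W U U2.
rewrite ltnS => Am pres pres2 UU2 ss2 ti ti2.
have [A0|/exists_minimal[q Aq q_min]] := eqVneq A set0.
  move: pres pres2; rewrite A0 cards0 => /presents_empty[W0 _].
  rewrite W0 => /presents_empty[_ nJ] c _ [b bU].
  by rewrite (bd_zero nJ bU) subr0 => /null_set0 ->; exact: bnd0.
have cA := card_setD1 Aq.
(* Both functions point at the lowest element of [W] over [q]. *)
have s2q : s2 q = s q.
  have [j sj Wj] := tight_start Aq q_min ti.
  have [j2 sj2 Wj2] := tight_start Aq q_min ti2.
  by have := tight_ge Aq q_min ti Wj2; have := tight_ge Aq q_min ti2 Wj; lia.
have raise2 (j : 'I_n) x : (raise s j q x <= raise s2 j q x)%N.
  by have := ss2 x; rewrite /raise; case: ifP => _; lia.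
case: (peelP Aq q_min pres) => [_ nt|_ nt|j sj Wj long acD pB|j sj Wj Wq pD pB] //.
- have s2j : s2 q = j by rewrite s2q.
  rewrite cA -(setD1K Wj); apply: inj_of_acyclic_delete => //.
    case: (peelP Aq q_min pres2) => [_ nt|_ nt|j2 sj2 _ _ acD2 _|j2 sj2 _ Wq2 _ _] //.
      by rewrite (_ : j = j2) //; apply: val_inj; rewrite /= -sj2.
    case: long => w; rewrite (_ : j = j2); last by apply: val_inj; rewrite /= -sj2.
    by move/Wq2 => /[swap] ->; rewrite eqxx.
  rewrite -cA; apply: (IH _ _ _ _ _ _ _ pB (presents_contract Aq q_min pres2 s2j Wj) UU2 (raise2 j)).
  + exact: measure_right.
  + exact/(tight_contract Aq q_min sj Wj).
  + exact/(tight_contract Aq q_min s2j Wj).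
have s2j : s2 q = j by rewrite s2q.
rewrite cA -(setD1K Wj); apply: inj_of_acyclic_contract => //.
  exact: (acyclic_above_short Aq sj Wq pB).
have pD2 : presents (A :\ q) s2 (W :\ (j, q)) (U2 :\ (j, q)).
  apply: presents_drop => //; first by rewrite s2j.
  exact: presents_delete.
apply: (IH _ _ _ _ _ _ _ pD pD2 (setSD _ UU2) ss2); first exact: measure_both.
- exact: (tight_drop (presents_homo pres) Aq q_min sj Wj Wq ti).
- exact: (tight_drop (presents_homo pres2) Aq q_min s2j Wj Wq ti2).
Qed.

(** When only [(j, q)] lies over [q], the homology of [W] is the kernel of the
    map from deletion to contraction over [A :\ q].  Either end may vanish, and
    otherwise [tight_inj] makes the kernel zero. *)
Theorem tight_homology A s W U : presents A s W U ->
  (tight A s W -> homology_line C #|A| W U) /\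
  (~ tight A s W -> acyclic C #|A| W U).
Proof.
have [m] := ubnP (#|A| + #|W|)%N.
elim: m A s W U => // m IH A s W U; rewrite ltnS => Am pres.
have [A0|/exists_minimal[q Aq q_min]] := eqVneq A set0.
  move: (pres); rewrite A0 cards0 => /presents_empty[W0 nJ]; split; last first.
    by case; exists s, s; split=> [x|x l|x y|x|x]; rewrite inE.
  move=> _; rewrite W0; exists (gen C); split; first exact: gen_within.
    case=> b bU; rewrite (bd_zero nJ bU) subr0 => /null_set0 /eqP.
    by rewrite (negbTE (gen_neq0 C)).
  by move=> c _; have [a ->] := gen_span c; exists a; rewrite subrr; exact: bnd0.
have cA := card_setD1 Aq; have sh := presents_homo pres.
case: (peelP Aq q_min pres) => [acyc nt|pD nt|j sj Wj long acD pB|j sj Wj Wq pD pB].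
- by split=> // _; exact: acyc.
- by split=> // _; apply: (acyclic_above pD); rewrite cA.
- have [|line acyc] := IH _ _ _ _ _ pB; first exact: measure_right.
  have tB := tight_contract Aq q_min sj Wj long.
  split=> ti.
    have {}line := line (tB.1 ti); rewrite cA in line *.
    by rewrite -(setD1K Wj); exact: line_of_acyclic_delete.
  have {}acyc : acyclic C #|A| (W :\ (j, q)) U by apply: acyc => /tB.
  by rewrite cA in acyc *; rewrite -(setD1K Wj); exact: acyclic_step.
have [|line acyc] := IH _ _ _ _ _ pD; first exact: measure_both.
have aU : acyclic C #|A :\ q|.+1 (W :\ (j, q)) U.
  exact: (acyclic_above_short Aq sj Wq pB).
rewrite cA -{2 4}(setD1K Wj).
have [tD|nD] := classic (tight (A :\ q) s (W :\ (j, q))); last first.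
  split=> [/(tight_drop sh Aq q_min sj Wj Wq) //|_].
  by apply: acyclic_step => //; exact: acyc.
have bq := raise_same sj.
have [jn|jn] := ltnP j.+1 n; last first.
  (* The contraction is the unit ideal. *)
  have jn' : j.+1 = n by have := ltn_ord j; lia.
  split=> [_|[]]; last first.
    by apply: (tight_undrop sh Aq q_min sj Wj Wq tD); right.
  apply: line_of_acyclic_contract (line tD) => //.
  by apply: (presents_unit Aq _ pB); rewrite bq.
have pDB : presents (A :\ q) (raise s j q) (W :\ (j, q)) U.
  by apply: presents_drop => //; rewrite bq.
have [tDB|nDB] := classic (tight (A :\ q) (raise s j q) (W :\ (j, q))).
  split=> [/(tight_contract_drop Aq q_min sj Wj Wq jn tDB) //|_].
  apply: acyclic_of_inj => //; apply: tight_inj pD pDB _ _ tD tDB.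
    exact: subsetDl.
  exact: raise_ge.
split=> [_|[]]; last first.
  by apply: (tight_undrop sh Aq q_min sj Wj Wq tD); left.
apply: line_of_acyclic_contract (line tD) => //.
by have [|_ acycB] := IH _ _ _ _ _ pDB; [exact: measure_both | exact: acycB].
Qed.

End Peeling.

(** * Tight staircases and gluing of layers *)

Section Layers.

Variables (disp : Order.disp_t) (P : finPOrderType disp) (n : nat).
Implicit Types (A B : {set P}) (R : {set 'I_n * P}) (p q x y : P) (i j l : 'I_n).

Lemma max_eltsP A p : reflect (p \in A /\ forall y, y \in A -> ~~ (p < y)%O) (p \in max_elts A).
Proof.
rewrite inE; apply: (iffP andP) => -[Ap H]; split=> //; last exact/forall_inP.
exact/forall_inP.
Qed.

Lemma min_eltsP A p : reflect (p \in A /\ forall y, y \in A -> ~~ (y < p)%O) (p \in min_elts A).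
Proof.
rewrite inE; apply: (iffP andP) => -[Ap H]; split=> //; last exact/forall_inP.
exact/forall_inP.
Qed.

Lemma antichainP A : reflect (forall x y, x \in A -> y \in A -> ~~ (x < y)%O) (antichain A).
Proof.
apply: (iffP forall_inP) => [H x y Ax Ay|H x Ax].
  rewrite lt_neqAle negb_and negbK.
  by move/forall_inP: (H x Ax) => /(_ y Ay) /implyP; case: (x <= y)%O => [->|] //; rewrite orbT.
apply/forall_inP => y Ay; apply/implyP => xy.
by move: (H x y Ax Ay); rewrite lt_neqAle xy andbT negbK.
Qed.

Lemma maximal_antichainP A : reflect
  (antichain A /\ forall p, exists2 a, a \in A & (a <= p)%O || (p <= a)%O)
  (maximal_antichain A).
Proof.
apply: (iffP maxsetP) => [[acA H]|[acA H]]; split=> //.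
  move=> p.
  apply: NNPP => no; have pA a : a \in A -> ~~ ((a <= p)%O || (p <= a)%O).
    by move=> Aa; apply/negP => ap; apply: no; exists a.
  suff AE : p |: A = A.
    have Ap : p \in A by rewrite -AE setU11.
    by have := pA p Ap; rewrite lexx.
  apply: H; last exact: subsetUr.
  apply/antichainP => x y; rewrite !in_setU1.
  case/orP=> [/eqP->|Ax]; case/orP=> [/eqP->|Ay]; rewrite ?ltxx //.
  - by have := pA y Ay; rewrite negb_or => /andP[_]; apply: contra; exact: ltW.
  - by have := pA x Ax; rewrite negb_or => /andP[+ _]; apply: contra; exact: ltW.
  - by move/antichainP: acA => /(_ x y Ax Ay).
move=> B acB AB; apply/eqP; rewrite eqEsubset AB andbT; apply/subsetP => p Bp.
have [a Aa] := H p; have Ba := subsetP AB a Aa.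
move/antichainP: acB => acB.
have [->//|nap] := eqVneq p a.
by rewrite !le_eqVlt (negbTE (acB _ _ Bp Ba)) (negbTE (acB _ _ Ba Bp)) eq_sym (negbTE nap).
Qed.

Section Necessity.

Variables (R : {set 'I_n * P}) (lo hi : P -> nat).
Hypothesis n_gt0 : (0 < n)%N.
Hypothesis P_gt0 : (0 < #|P|)%N.
Hypothesis st : staircase [set: P] (fun=> 0%N) R lo hi.

Let lohi p : (lo p <= hi p < n)%N.
Proof. by case: st => /(_ p (in_setT p)) [_ lh hn] _ _ _ _; apply/andP. Qed.
Let mem p l : ((l, p) \in R) = (lo p <= l <= hi p)%N.
Proof. by case: st => _ -> //; rewrite inE. Qed.
Let ord x y : (x < y)%O -> (hi x <= lo y)%N.
Proof. by case: st => _ _ H _ _; apply: H; rewrite inE. Qed.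
Let low p : lo p = 0%N \/ exists2 x, (x < p)%O & hi x = lo p.
Proof. by case: st => _ _ _ /(_ p (in_setT p)) [l0|[x [_ xp xE]]] _; [left|right; exists x]. Qed.
Let high p : hi p = n.-1 \/ exists2 y, (p < y)%O & lo y = hi p.
Proof. by case: st => _ _ _ _ /(_ p (in_setT p)) [|[x [_ xp xE]]]; [left|right; exists x]. Qed.

Lemma staircase_layer p l : (p \in layer R l) = (lo p <= l <= hi p)%N.
Proof. by rewrite inE mem. Qed.

(** Take [q] maximal above [p] with [lo q <= m].  Its interval cannot end by
    layer [m], short of the last layer, since some [y] above [q] would then start
    where it ends. *)
Lemma climb p (m : nat) : (lo p <= m < n)%N ->
  exists q, [/\ (p <= q)%O, (lo q <= m)%N & (m < hi q)%N \/ hi q = n.-1].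
Proof.
case/andP=> pm mn; have [q [qm pq qmax]] := exists_max_above (K := fun q => lo q <= m)%N pm.
exists q; split=> //; have [|[y qy loy]] := high q; first by right.
by left; have := qmax y qy; rewrite -ltnNge loy.
Qed.

Lemma descend p (m : nat) : (m < hi p)%N ->
  exists q, [/\ (q <= p)%O, (m < hi q)%N & (lo q <= m)%N].
Proof.
move=> mp; have [q [qm pq qmin]] := exists_min_below (K := fun q => m < hi q)%N mp.
exists q; split=> //; have [->//|[x xq hix]] := low q.
by have := qmin x xq; rewrite -leqNgt hix.
Qed.

Lemma layer_neq0 l : layer R l != set0.
Proof.
have /card_gt0P[p0 _] := P_gt0.
have [p [_ _ pmin]] := exists_min_below (K := predT) (p := p0) isT.
have lop : lo p = 0%N by have [//|[x /pmin]] := low p.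
have [|q [_ loq hiq]] := climb (p := p) (m := l); first by rewrite lop ltn_ord.
apply/set0Pn; exists q; rewrite staircase_layer loq /=.
by have := ltn_ord l; case: hiq; lia.
Qed.

Lemma max_layer i j : j = i.+1 :> nat ->
  max_elts (layer R i) = [set p | lo p <= i < hi p]%N.
Proof.
move=> ji; apply/setP => p; rewrite [RHS]inE; have := ltn_ord j => jn.
apply/max_eltsP/andP; rewrite staircase_layer => -[].
  case/andP=> lop hip pmax; split=> //; rewrite ltn_neqAle hip andbT.
  apply/eqP => ip; have [|[y py loy]] := high p; first lia.
  suff yi : y \in layer R i by have := pmax y yi; rewrite py.
  by rewrite staircase_layer loy -ip leqnn; have := lohi y; lia.
move=> lop hip; split; first by rewrite lop ltnW.
by move=> y; rewrite staircase_layer => yi; apply/negP => /ord; lia.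
Qed.

Lemma min_layer i j : j = i.+1 :> nat ->
  min_elts (layer R j) = [set p | lo p <= i < hi p]%N.
Proof.
move=> ji; apply/setP => p; rewrite [RHS]inE.
apply/min_eltsP/andP; rewrite staircase_layer ji => -[].
  case/andP=> lop hip pmin; split=> //; rewrite leqNgt; apply/negP => ip.
  have [|[x xp hix]] := low p; first lia.
  suff xj : x \in layer R j by have := pmin x xj; rewrite xp.
  by rewrite staircase_layer ji hix; have := lohi x; lia.
move=> lop hip; split; first by rewrite hip; lia.
by move=> x; rewrite staircase_layer ji => xj; apply/negP => /ord; lia.
Qed.

Lemma cut_maximal_antichain i j : j = i.+1 :> nat ->
  maximal_antichain [set p | lo p <= i < hi p]%N.
Proof.
move=> ji; have jn := ltn_ord j; apply/maximal_antichainP; split.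
  apply/antichainP => x y; rewrite !inE => xi yi; apply/negP => /ord; lia.
move=> p; have [hip|hip] := ltnP i (hi p).
  have [q [qp iq loq]] := descend hip.
  by exists q; rewrite ?qp // inE loq.
have [|q [pq loq hiq]] := climb (p := p) (m := i).
  by have := lohi p; lia.
by exists q; rewrite ?pq ?orbT // inE loq; case: hiq; lia.
Qed.

Lemma staircase_layers :
  [/\ layers_increasing R, layers_cover R & layers_glue R].
Proof.
split.
- split=> [l|i j ji]; first exact: layer_neq0.
  split; try exact: layer_neq0.
    by move=> a; rewrite (max_layer ji) -(min_layer ji); exists a.
  by move=> a; rewrite (min_layer ji) -(max_layer ji); exists a.
- apply/setP => p; rewrite [RHS]inE; have /andP[lh hn] := lohi p.
  apply/bigcupP; exists (Ordinal hn) => //.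
  by rewrite staircase_layer /= lh leqnn.
move=> i j ji; rewrite (max_layer ji) (min_layer ji).
by split=> //; exact: cut_maximal_antichain ji.
Qed.

End Necessity.

Section Sufficiency.

Variable R : {set 'I_n * P}.
Hypothesis n_gt0 : (0 < n)%N.
Hypothesis cover : layers_cover R.
Hypothesis glue : layers_glue R.

Let inR (m : nat) p := [exists l : 'I_n, (l == m :> nat) && ((l, p) \in R)].

Lemma inR_ord l p : inR l p = ((l, p) \in R).
Proof.
apply/existsP/idP => [[l' /andP[/eqP/val_inj->]]//|Rp].
by exists l; rewrite eqxx.
Qed.

Lemma inR_lt m p : inR m p -> (m < n)%N.
Proof. by case/existsP=> l /andP[/eqP <- _]; exact: ltn_ord. Qed.

Lemma inR_ex p : exists m, inR m p.
Proof.
have : p \in \bigcup_(i < n) layer R i by rewrite cover inE.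
by case/bigcupP => l _; rewrite inE -inR_ord; exists l.
Qed.

Let wall m : {set P} := [set p | inR m p & inR m.+1 p].

Lemma inR_layer m p (mn : (m < n)%N) : inR m p = (p \in layer R (Ordinal mn)).
Proof. by rewrite inE -inR_ord. Qed.

(** An element common to two consecutive layers is comparable with some element of
    the gluing antichain, which consists of maximal elements of one layer and
    minimal elements of the next, so it belongs to that antichain. *)
Lemma wallE m (mn : (m < n)%N) (m1n : (m.+1 < n)%N) :
  [/\ wall m = max_elts (layer R (Ordinal mn)),
      wall m = min_elts (layer R (Ordinal m1n)) & maximal_antichain (wall m)].
Proof.
have [maxmin ma] := glue (i := Ordinal mn) (j := Ordinal m1n) erefl.
suff -> : wall m = max_elts (layer R (Ordinal mn)) by rewrite -maxmin.
apply/setP => p; rewrite inE (inR_layer p mn) (inR_layer p m1n).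
apply/andP/idP => [[p0 p1]|pm]; last first.
  split; first by case/max_eltsP: pm.
  by move: pm; rewrite maxmin => /min_eltsP[].
move/maximal_antichainP: ma => -[acm cmp].
have [a am apa] := cmp p; suff -> : p = a by [].
have pa : ~~ (p < a)%O by move: (am); rewrite maxmin => /min_eltsP[_]; apply.
have ap : ~~ (a < p)%O by case/max_eltsP: am => _; apply.
apply/eqP; case/orP: apa => le; last by rewrite lt_neqAle le andbT negbK in pa.
by rewrite lt_neqAle le andbT negbK eq_sym in ap.
Qed.

Lemma below_wall m p : (m.+1 < n)%N -> inR m p ->
  exists2 a, a \in wall m & (p <= a)%O.
Proof.
move=> m1n Rp; have [-> _ _] := wallE (ltnW m1n) m1n.
have [a [Ka pa amax]] := exists_max_above (K := inR m) Rp.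
exists a => //; apply/max_eltsP; rewrite -inR_layer; split=> // y.
by rewrite -inR_layer => Ry; apply/negP => /amax; rewrite Ry.
Qed.

Lemma above_wall m p : inR m.+1 p -> exists2 a, a \in wall m & (a <= p)%O.
Proof.
move=> Rp; have m1n := inR_lt Rp; have [_ -> _] := wallE (ltnW m1n) m1n.
have [a [Ka pa amin]] := exists_min_below (K := inR m.+1) Rp.
exists a => //; apply/min_eltsP; rewrite -inR_layer; split=> // y.
by rewrite -inR_layer => Ry; apply/negP => /amin; rewrite Ry.
Qed.

Lemma below_walls (l m : nat) p : (l <= m)%N -> (m.+1 < n)%N -> inR l p ->
  exists2 a, a \in wall m & (p <= a)%O.
Proof.
elim: m => [|m IH] in l p *.
  by rewrite leqn0 => /eqP->; exact: below_wall.
rewrite leq_eqVlt => /orP[/eqP->|lm]; first exact: below_wall.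
move=> mn Rp; have [a] := IH l p lm (ltnW mn) Rp; rewrite inE => /andP[_ Ra] pa.
have [b bw ab] := below_wall mn Ra; exists b => //; exact: le_trans ab.
Qed.

Lemma above_walls (l m : nat) p : (m < l)%N -> inR l p -> exists2 a, a \in wall m & (a <= p)%O.
Proof.
elim: l => // l IH in p *; rewrite ltnS leq_eqVlt => /orP[/eqP->|ml].
  exact: above_wall.
move=> /above_wall[a]; rewrite inE => /andP[Ra _] ap.
have [b bw ba] := IH a ml Ra; exists b => //; exact: le_trans ap.
Qed.

Lemma wall_flat m a b : (m.+1 < n)%N -> a \in wall m -> b \in wall m -> ~~ (a < b)%O.
Proof.
move=> m1n; have [_ _ /maximal_antichainP[/antichainP H _]] := wallE (ltnW m1n) m1n.
exact: H.
Qed.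

(** An element of layers [l] and [m] lies below the wall following layer [i - 1]
    and above it, hence on it. *)
Lemma inR_convex (l i m : nat) p : inR l p -> inR m p -> (l <= i <= m)%N -> inR i p.
Proof.
move=> Rl Rm /andP[]; rewrite leq_eqVlt => /orP[/eqP<-//|li] im.
have mn := inR_lt Rm; case: i li im => // i li im.
have [a aw pa] := below_walls (m := i) li (leq_ltn_trans im mn) Rl.
have [b bw bp] := above_walls im Rm.
have : ~~ (b < a)%O by exact: wall_flat (leq_ltn_trans im mn) bw aw.
rewrite lt_neqAle (le_trans bp pa) andbT negbK => /eqP ba.
have -> : p = a by apply/le_anti; rewrite pa -ba bp.
by move: aw; rewrite inE => /andP[].
Qed.

Lemma inR_order (l m : nat) x p : (x < p)%O -> inR m x -> inR l p -> (m <= l)%N.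
Proof.
move=> xp Rm Rl; rewrite leqNgt; apply/negP => lm.
have mn := inR_lt Rm; have l1n : (l.+1 < n)%N by exact: leq_ltn_trans mn.
have [a aw pa] := below_wall l1n Rl; have [b bw bx] := above_walls lm Rm.
have /negP[] := wall_flat l1n bw aw.
exact: le_lt_trans bx (lt_le_trans xp pa).
Qed.

Lemma layers_tight : tight [set: P] (fun=> 0%N) R.
Proof.
have bnd p m : inR m p -> (m <= n)%N by move/inR_lt/ltnW.
pose lo p := ex_minn (inR_ex p); pose hi p := ex_maxn (inR_ex p) (bnd p).
have lo_in p : inR (lo p) p by rewrite /lo; case: ex_minnP.
have hi_in p : inR (hi p) p by rewrite /hi; case: ex_maxnP.
have lo_le p m : inR m p -> (lo p <= m)%N by rewrite /lo; case: ex_minnP => ? _; apply.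
have hi_ge p m : inR m p -> (m <= hi p)%N by rewrite /hi; case: ex_maxnP => ? _; apply.
exists lo, hi; split.
- by move=> p _; split=> //; [exact: lo_le | exact: inR_lt (hi_in p)].
- move=> p l _; rewrite -inR_ord; apply/idP/idP => [Rp|]; first by rewrite lo_le ?hi_ge.
  exact: inR_convex.
- by move=> x p _ _ xp; exact: inR_order xp (hi_in x) (lo_in p).
- move=> p _; have [|] := posnP (lo p); first by left.
  case E : (lo p) => [//|m] _; right.
  have Rp : inR m.+1 p by rewrite -E.
  have [a aw ap] := above_wall Rp; move: (aw); rewrite inE => /andP[Ra0 Ra1].
  have xp : (a < p)%O.
    rewrite lt_neqAle ap andbT; apply/eqP => ap'; move: Ra0; rewrite ap' => /lo_le.
    by rewrite E ltnn.
  exists a; split; rewrite ?inE //; apply/eqP; rewrite eqn_leq hi_ge // andbT.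
  exact: inR_order xp (hi_in a) Rp.
move=> p _; have := inR_lt (hi_in p); rewrite -{1}(prednK n_gt0) ltnS leq_eqVlt.
case/orP=> [/eqP|hn]; first by left.
have h1n : ((hi p).+1 < n)%N by lia.
right; have [a aw pa] := below_wall h1n (hi_in p).
move: (aw); rewrite inE => /andP[Ra0 Ra1].
have pa' : (p < a)%O.
  rewrite lt_neqAle pa andbT; apply/eqP => ap; move: Ra1; rewrite -ap => /hi_ge.
  by rewrite ltnn.
exists a; split; rewrite ?inE //; apply/eqP; rewrite eqn_leq lo_le //=.
exact: inR_order pa' (hi_in p) (lo_in a).
Qed.

End Sufficiency.

Lemma tight_layersP R : (0 < n)%N -> (0 < #|P|)%N ->
  tight [set: P] (fun=> 0%N) R <->
  [/\ layers_increasing R, layers_cover R & layers_glue R].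
Proof.
move=> n_gt0 P_gt0; split=> [[lo [hi st]]|[_ cov gl]].
  exact: staircase_layers st.
exact: layers_tight.
Qed.

End Layers.

(** * The squarefree part of a free resolution *)

Section Monomials.

Variables (k : fieldType) (N : nat).
Implicit Types (p : {mpoly k[N]}) (m : 'X_{1..N}).

(** Setting all variables to [1].  An entry of a multigraded map is a scalar times
    a monomial, and this extracts the scalar. *)
Definition at1 : {mpoly k[N]} -> k := meval (fun=> 1).

Lemma monomial_at1 p m0 : (forall m, m \in msupp p -> m = m0) ->
  p = at1 p *: 'X_[m0].
Proof.
move=> pm0; have pE : p = p@_m0 *: 'X_[m0].
  apply/mpolyP => m; rewrite mcoeffZ mcoeffX.
  have [<-|nm] := eqVneq m0 m; first by rewrite mulr1.
  by rewrite mulr0 memN_msupp_eq0 //; apply: contraNN nm => /pm0 ->.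
rewrite {1}pE /at1 {2}pE mevalZ mevalX big1 ?mulr1 // => i _.
by rewrite expr1n.
Qed.

Lemma mcoeffMX_nlep p m m' : ~~ (m <= m')%MM -> (p * 'X_[m])@_m' = 0.
Proof.
move=> nle; rewrite mcoeffM big1 // => -[m1 m2] /= /eqP m'E.
rewrite mcoeffX; case: eqP => [mE|]; last by rewrite mulr0.
by case/negP: nle; rewrite m'E mE; apply/mnm_lepP => i; rewrite mnmDE leq_addl.
Qed.

End Monomials.

Section Augmentation.

Variables (k : fieldType) (n : nat) (disp : Order.disp_t).
Variable P : finPOrderType disp.
Notation N := (nvars n P).
Variables (I : {mpoly k[N]} -> Prop) (F : graded_free_resolution I).
Implicit Types (U W R : {set 'I_n * P}).

(** The resolution shifted up by one, with the polynomial ring in degree [0]; the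
    augmentation becomes the lowest differential. *)
Definition aug_rk (i : nat) : nat := if i is i'.+1 then rk F i' else 1%N.

Definition aug_deg (i : nat) : 'I_(aug_rk i) -> 'X_{1..N} :=
  if i is i'.+1 return 'I_(aug_rk i) -> 'X_{1..N} then @deg _ _ _ F i'
  else fun=> 0%MM.

Definition aug_diff (i : nat) : 'M[{mpoly k[N]}]_(aug_rk i.+1, aug_rk i) :=
  if i is i'.+1 return 'M_(aug_rk i.+1, aug_rk i) then diff F i' else aug F.

Definition aug_bd (i : nat) : 'M[k]_(aug_rk i.+1, aug_rk i) :=
  map_mx (@at1 k N) (aug_diff i).

Definition below (i : nat) (j : 'I_(aug_rk i)) U : bool :=
  (aug_deg j <= mdeg_set U)%MM.

Lemma aug_homogeneous i a b m : m \in msupp (aug_diff i a b) ->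
  (m + aug_deg b)%MM = aug_deg a.
Proof.
case: i a b => [|i] a b /=; last exact: diff_homogeneous.
by rewrite addm0 (ord1 b) => /aug_homogeneous.
Qed.

Lemma aug_diff_exact i (v : 'rV_(aug_rk i.+1)) :
  v *m aug_diff i = 0 <-> exists w : 'rV_(aug_rk i.+2), v = w *m aug_diff i.+1.
Proof. by case: i v => [|i] v; [exact: exact_aug | exact: exact_diff]. Qed.

Lemma aug_diffE i a b :
  aug_diff i a b = aug_bd i a b *: 'X_[aug_deg a - aug_deg b].
Proof.
rewrite mxE; apply: monomial_at1 => m /aug_homogeneous <-.
by rewrite addmK.
Qed.

Lemma aug_bd_deg i a b : aug_bd i a b != 0 -> (aug_deg b <= aug_deg a)%MM.
Proof.
rewrite mxE => nz; have : aug_diff i a b != 0.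
  by apply: contraNneq nz => ->; rewrite /at1 raddf0.
rewrite -msupp_eq0; case E : (msupp _) => [//|m s] _.
have := @aug_homogeneous i a b m; rewrite E mem_head => /(_ isT) <-.
by apply/mnm_lepP => x; rewrite mnmDE leq_addl.
Qed.

(** The homogeneous element of degree [U] with the given scalars as coefficients;
    [component U] recovers them, so exactness over the polynomial ring passes to
    the scalar complexes. *)
Definition homogenize i U (c : 'rV[k]_(aug_rk i)) : 'rV[{mpoly k[N]}]_(aug_rk i) :=
  \row_j (c 0 j *: 'X_[mdeg_set U - aug_deg j]).

Definition component i U (w : 'rV[{mpoly k[N]}]_(aug_rk i)) : 'rV[k]_(aug_rk i) :=
  \row_j (if below j U then (w 0 j)@_(mdeg_set U - aug_deg j) else 0).

Lemma submA_lep (m1 m2 m3 : 'X_{1..N}) : (m3 <= m2)%MM -> (m2 <= m1)%MM ->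
  ((m1 - m2) + (m2 - m3) = m1 - m3)%MM.
Proof.
move=> /mnm_lepP h1 /mnm_lepP h2; apply/mnmP => x; rewrite !mnmE.
by have := h1 x; have := h2 x; lia.
Qed.

Lemma component_below i U w : supp_in (fun j : 'I_(aug_rk i) => below j U) (component U w).
Proof. by move=> j; rewrite mxE; case: ifP => //; rewrite eqxx. Qed.

Lemma homogenize_mul i U (c : 'rV_(aug_rk i.+1)) :
  supp_in (fun j => below j U) c ->
  homogenize U c *m aug_diff i = homogenize U (c *m aug_bd i).
Proof.
move=> cU; apply/rowP => b; rewrite !mxE scaler_suml; apply: eq_bigr => a _.
rewrite mxE aug_diffE -scalerAl -scalerAr scalerA -mpolyXD.
have [->|/cU aU] := eqVneq (c 0 a) 0; first by rewrite !mul0r !scale0r.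
have [->|/aug_bd_deg ba] := eqVneq (aug_bd i a b) 0.
  by rewrite !mulr0 !scale0r.
by rewrite submA_lep.
Qed.

Lemma component_mul i U (w : 'rV_(aug_rk i.+1)) :
  component U (w *m aug_diff i) = component U w *m aug_bd i.
Proof.
apply/rowP => b; rewrite !mxE; case: ifP => [bU|/negbT nbU].
  rewrite raddf_sum; apply: eq_bigr => a _ /=.
  rewrite [component U w 0 a]mxE aug_diffE -scalerAr mcoeffZ mulrC.
  have [->|/aug_bd_deg ba] := eqVneq (aug_bd i a b) 0; first by rewrite !mulr0.
  congr (_ * _); case: ifP => [aU|/negbT naU].
    by rewrite -(submA_lep ba aU) addmC mcoeffMX.
  apply: mcoeffMX_nlep; apply: contra naU => /mnm_lepP le; apply/mnm_lepP => x.
  have := le x; rewrite !mnmBE; have := mnm_lepP ba x; have := mnm_lepP bU x.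
  by lia.
rewrite big1 // => a _; rewrite mxE.
have [->|/aug_bd_deg ba] := eqVneq (aug_bd i a b) 0; first by rewrite mulr0.
case: ifP => [aU|_]; last by rewrite mul0r.
by case/negP: nbU; exact: lepm_trans ba aU.
Qed.

Lemma homogenizeK i U (c : 'rV_(aug_rk i)) : supp_in (fun j => below j U) c ->
  component U (homogenize U c) = c.
Proof.
move=> cU; apply/rowP => j; rewrite !mxE mcoeffZ mcoeffX eqxx mulr1.
by case: ifPn => // nj; apply/esym/eqP; apply: contraR nj => /cU.
Qed.

Lemma homogenize0 i U : homogenize U (0 : 'rV_(aug_rk i)) = 0.
Proof. by apply/rowP => j; rewrite !mxE scale0r. Qed.

Lemma below_set i (j : 'I_(aug_rk i)) U :
  below j U = [forall e : 'I_n * P, (aug_deg j (enum_rank e) <= (e \in U))%N].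
Proof.
apply/mnm_lepP/forallP => H x; first by have := H (enum_rank x); rewrite /mdeg_set mnmE enum_rankK.
by rewrite /mdeg_set mnmE -{1}[x]enum_valK.
Qed.

Let aug_bd_bd i : aug_bd i.+1 *m aug_bd i = 0.
Proof.
rewrite -map_mxM (_ : _ *m _ = 0); first by apply/matrixP => a b; rewrite !mxE /at1 raddf0.
apply/row_matrixP => a; rewrite row_mul row0; apply/aug_diff_exact.
by exists (delta_mx 0 a); rewrite rowE.
Qed.

Let aug_exact i U (c : 'rV_(aug_rk i.+1)) :
  supp_in (fun j => below j U) c -> c *m aug_bd i = 0 ->
  exists2 b : 'rV_(aug_rk i.+2), supp_in (fun j => below j U) b & c = b *m aug_bd i.+1.
Proof.
move=> cU c0; have : homogenize U c *m aug_diff i = 0.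
  by rewrite homogenize_mul // c0 homogenize0.
case/aug_diff_exact => w wE; exists (component U w); first exact: component_below.
by rewrite -component_mul -wE homogenizeK.
Qed.

Definition contains_set U : Prop := I 'X_[mdeg_set U].

Let aug_onto U : contains_set U ->
  exists2 b : 'rV_(aug_rk 1), supp_in (fun j => below j U) b &
    b *m aug_bd 0 = const_mx 1.
Proof.
case/(iffLR (aug_image F _)) => v vE; exists (component (i := 1) U v); first exact: component_below.
rewrite -(component_mul (i := 0)); apply/rowP => j; rewrite (ord1 j) [LHS]mxE [RHS]mxE.
have -> : below (0 : 'I_(aug_rk 0)) U by apply/mnm_lepP => x; rewrite mnm0E.
by rewrite /= vE subm0 mcoeffX eqxx.
Qed.

Let aug_zero U (b : 'rV_(aug_rk 1)) : ~ contains_set U ->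
  supp_in (fun j => below j U) b -> b *m aug_bd 0 = 0.
Proof.
move=> nJ bU; apply/rowP => j; rewrite (ord1 j) [RHS]mxE.
have [//|nz] := eqVneq ((b *m aug_bd 0) 0 0) 0; case: nJ.
rewrite /contains_set; apply: (iffRL (aug_image F _)).
exists (((b *m aug_bd 0) 0 0)^-1%:MP *: homogenize U b).
have -> : (((b *m aug_bd 0) 0 0)^-1%:MP *: homogenize U b) *m aug F
        = ((b *m aug_bd 0) 0 0)^-1%:MP *: homogenize (i := 0) U (b *m aug_bd 0).
  by rewrite -scalemxAl -(homogenize_mul bU).
rewrite mxE [homogenize _ _ _ _]mxE subm0.
by rewrite -mul_mpolyC mulrA -mpolyCM mulVf // mpolyC1 mul1r.
Qed.

(** Kept transparent, because Betti numbers are computed from the ranks and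
    differentials of the resolution itself. *)
Definition squarefree_part : set_resolution k contains_set.
Proof.
apply: (@SetResolution k _ contains_set aug_rk aug_bd below (const_mx 1)).
- move=> i a U U' UU'; rewrite !below_set => /forallP aU; apply/forallP => x.
  apply: leq_trans (aU x) _; by have := subsetP UU' x; case: (x \in U) => // ->.
- move=> i a U U'; rewrite !below_set => /forallP aU /forallP aU'.
  apply/forallP => x; rewrite in_setI; have := aU x; have := aU' x.
  by case: (x \in U); case: (x \in U').
- by move=> i a b U aU /aug_bd_deg ba; exact: lepm_trans ba aU.
- exact: aug_bd_bd.
- by apply/eqP => /rowP /(_ 0) /eqP; rewrite !mxE oner_eq0.
- by move=> U j _; apply/mnm_lepP => x; rewrite mnm0E.
- by move=> c; exists (c 0 0); apply/rowP => j; rewrite !mxE (ord1 j) mulr1.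
- exact: aug_exact.
- exact: aug_onto.
- exact: aug_zero.
Defined.

End Augmentation.

(** * Betti numbers as relative homology *)

Section BettiNumbers.

Variables (k : fieldType) (n : nat) (disp : Order.disp_t).
Variable P : finPOrderType disp.
Notation N := (nvars n P).
Variables (I : {mpoly k[N]} -> Prop) (F : graded_free_resolution I).
Variable R : {set 'I_n * P}.
Hypothesis proper : ~ contains_set I set0.

Let C := squarefree_part F.
Let exact_deg i : pred 'I_(rk F i) := fun j => deg j == mdeg_set R.

(** In the complex relative to [R] over [R] exactly the basis elements of degree
    [R] survive. *)
Lemma partial_deg i (j : 'I_(aug_rk F i)) :
  below j R -> @partial _ _ _ C i R R j = (aug_deg j != mdeg_set R).
Proof.
rewrite below_set => /forallP jR; apply/exists_inP/idP => [[w Rw]|].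
  rewrite /= below_set => /forallP /(_ w); rewrite !inE eqxx /= leqn0 => jw.
  by apply: contraTneq jw => ->; rewrite /mdeg_set mnmE enum_rankK Rw.
move=> njR; have [w] : exists w, aug_deg j (enum_rank w) != (w \in R).
  apply/existsP; apply: contraR njR; rewrite negb_exists => /forallP jE.
  apply/eqP/mnmP => x; rewrite /mdeg_set mnmE.
  by have := jE (enum_val x); rewrite negbK enum_valK => /eqP.
move=> jw; have := jR w; rewrite leq_eqVlt (negbTE jw) /= => jw'.
have Rw : w \in R by case: (w \in R) jw'.
exists w => //; rewrite /= below_set; apply/forallP => x; rewrite !inE.
have [->|_] := eqVneq x w; last exact: jR.
by move: jw'; rewrite Rw ltnS leqn0.
Qed.

Lemma exact_chain i (c : 'rV_(rk F i)) :
  supp_in (@exact_deg i) c -> @chain _ _ _ C i.+1 R c.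
Proof. by move=> cR j /cR /eqP jR; rewrite /= /below /= jR lepm_refl. Qed.

Lemma null_exact i (c : 'rV_(rk F i)) : @chain _ _ _ C i.+1 R c ->
  @null _ _ _ C i.+1 R R c <-> cut (@exact_deg i) c = 0.
Proof.
move=> cR; split=> [cN|c0].
  apply/rowP => j; rewrite !mxE; case: ifP => // jR.
  apply/eqP; apply: contraTT jR => nz; have jN := cN j nz.
  by rewrite partial_deg in jN; last exact: (cR j nz).
move=> j nz; rewrite partial_deg; last exact: cR nz.
apply: contraNneq nz => jR; move/rowP/(_ j): c0; rewrite !mxE /exact_deg.
by move: jR => /= ->; rewrite eqxx => ->.
Qed.

Lemma cut_null i (c : 'rV_(rk F i)) : @chain _ _ _ C i.+1 R c ->
  @null _ _ _ C i.+1 R R (c - cut (@exact_deg i) c).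
Proof.
move=> cR; apply/null_exact.
  by apply: supp_inB => //; apply: exact_chain; exact: cut_supp.
by rewrite cutB [cut _ (cut _ _)]cut_id ?subrr //; exact: cut_supp.
Qed.

(** A nonzero entry between basis elements of degree [R] is constant, while an
    entry from degree [R] to a smaller degree has no constant term. *)
Lemma diff_k_cut i (c : 'rV_(rk F i.+1)) : supp_in (@exact_deg i.+1) c ->
  c *m diff_k F i = cut (@exact_deg i) (c *m aug_bd F i.+1).
Proof.
move=> cR; apply/rowP => b; rewrite mxE [RHS]mxE.
transitivity (\sum_a (if exact_deg b then c 0 a * aug_bd F i.+1 a b else 0)).
  apply: eq_bigr => a _; have [->|/cR /eqP aR] := eqVneq (c 0 a) 0.
    by rewrite !mul0r; case: ifP.
  rewrite mxE [diff F i a b](aug_diffE (i := i.+1)) mcoeffZ mcoeffX.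
  have [->|/aug_bd_deg /= ba] := eqVneq (aug_bd F i.+1 a b) 0.
    by rewrite mul0r mulr0; case: ifP.
  rewrite /exact_deg -aR; case: eqP => [|nab].
    move=> ab0; have := submK ba; rewrite ab0 add0m => ->.
    by rewrite eqxx mulr1.
  case: eqP => [ba'|_]; last by rewrite !mulr0.
  by case: nab; rewrite /= ba'; apply/mnmP => x; rewrite mnmBE subnn mnm0E.
by case: ifP => _; [rewrite mxE | rewrite big1].
Qed.

Lemma sub_strand i (c : 'rV_(rk F i)) :
  (c <= strand F i (mdeg_set R))%MS <-> supp_in (@exact_deg i) c.
Proof.
rewrite /strand; split=> [/submxP[D ->] j|cR].
  rewrite mul_mx_diag !mxE; apply: contraNT => /negbTE jR.
  by rewrite -/(exact_deg j) jR mulr0.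
apply/submxP; exists c; apply/rowP => j; rewrite mul_mx_diag !mxE.
have [->|/cR jR] := eqVneq (c 0 j) 0; first by rewrite mul0r.
by rewrite -/(exact_deg j) jR mulr1.
Qed.

Lemma sub_cycles i (c : 'rV_(rk F i)) : (c <= cycles F i (mdeg_set R))%MS <->
  supp_in (@exact_deg i) c /\ @cyc _ _ _ C i.+1 R R c.
Proof.
case: i c => [|i] c; rewrite /cycles.
  rewrite sub_strand; split=> [cR|[]//]; split=> //; split; first exact: exact_chain.
  have [R0|/set0Pn[w Rw]] := eqVneq R set0.
    have cR' := exact_chain cR; rewrite R0 in cR' *.
    by rewrite (bd_zero proper cR'); exact: supp_in0.
  by move=> j _; apply/exists_inP; exists w => //; apply/mnm_lepP => x; rewrite mnm0E.
rewrite sub_capmx; split=> [/andP[/sub_strand cR /sub_kermxP c0]|[cR [_ cN]]].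
  split=> //; split; first exact: exact_chain.
  apply/null_exact; last by rewrite -diff_k_cut.
  exact: chain_bd (exact_chain cR).
apply/andP; split; first exact/sub_strand.
apply/sub_kermxP; rewrite diff_k_cut //; apply/null_exact => //.
exact: null_chain cN.
Qed.

Lemma sub_boundaries i (c : 'rV_(rk F i)) :
  (c <= boundaries F i (mdeg_set R))%MS <->
  supp_in (@exact_deg i) c /\ @bnd _ _ _ C i.+1 R R c.
Proof.
rewrite /boundaries; split=> [/submxP[D]|[cR [b bR bc]]].
  rewrite mulmxA; set u := D *m _ => cE.
  have uR : supp_in (@exact_deg i.+1) u by apply/sub_strand; exact: submxMl.
  rewrite diff_k_cut // in cE; split; first by rewrite cE; exact: cut_supp.
  exists u; first exact: exact_chain.
  rewrite cE -opprB; apply/supp_inN/cut_null.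
  exact: chain_bd (exact_chain uR).
pose u := cut (@exact_deg i.+1) b.
have uR : supp_in (@exact_deg i.+1) u by exact: cut_supp.
have -> : c = u *m diff_k F i.
  have cN : @null _ _ _ C i.+1 R R (c - u *m aug_bd F i.+1).
    have := supp_inD bc (null_bd (cut_null bR)).
    by rewrite mulmxBl addrA subrK.
  have := iffLR (null_exact (null_chain cN)) cN.
  by rewrite cutB cut_id // diff_k_cut // => /eqP; rewrite subr_eq0 => /eqP.
have [D ->] := submxP (iffRL (sub_strand u) uR).
by rewrite -mulmxA submxMl.
Qed.

Lemma betti_acyclic i : acyclic C i.+1 R R -> betti F i (mdeg_set R) = 0%N.
Proof.
move=> acyc; apply/eqP; rewrite subn_eq0; apply: mxrankS; apply/row_subP => r.
have /sub_cycles[rR rZ] := row_sub r (cycles F i (mdeg_set R)).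
by apply/sub_boundaries; split=> //; exact: acyc.
Qed.

Lemma boundaries_sub i :
  (boundaries F i (mdeg_set R) <= cycles F i (mdeg_set R))%MS.
Proof.
apply/row_subP => r.
have /sub_boundaries[rR rB] := row_sub r (boundaries F i (mdeg_set R)).
by apply/sub_cycles; split=> //; exact: bnd_cyc.
Qed.

Lemma betti_line i : homology_line C i.+1 R R -> betti F i (mdeg_set R) = 1%N.
Proof.
case=> z0 [z0Z z0nB z0span]; pose z := cut (@exact_deg i) z0.
have zR : supp_in (@exact_deg i) z by exact: cut_supp.
have zB : @bnd _ _ _ C i.+1 R R (z0 - z).
  exact/null_bnd/cut_null/(cyc_chain z0Z).
have zZ : @cyc _ _ _ C i.+1 R R z.
  by rewrite -[z](subKr z0); apply: cycB z0Z (bnd_cyc zB).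
have znB : ~ @bnd _ _ _ C i.+1 R R z.
  by move=> /(bndD zB); rewrite subrK.
set B := boundaries F i (mdeg_set R); set Z := cycles F i (mdeg_set R).
have BZ : (B <= Z)%MS := boundaries_sub i.
have zZ' : (z <= Z)%MS by apply/sub_cycles.
have znB' : ~~ (z <= B)%MS by apply/negP => /sub_boundaries[].
have ZBz : (Z <= B + z)%MS.
  apply/row_subP => r; have /sub_cycles[rR rZ] := row_sub r Z.
  have [a rB] := z0span _ rZ.
  rewrite -[row r Z](subrK (a *: z)); apply: addmx_sub_adds; last exact: scalemx_sub.
  apply/sub_boundaries; split; first by apply: supp_inB => //; exact: supp_inZ.
  have := bndD rB (bndZ a zB).
  by rewrite scalerBr addrA subrK.
have rZ : (\rank Z <= \rank B + 1)%N.
  apply: leq_trans (mxrankS ZBz) _; apply: leq_trans (mxrank_adds_leqif _ _) _.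
  by rewrite leq_add2l rank_leq_row.
have rB : (\rank B < \rank Z)%N.
  have : (B < Z)%MS.
    by rewrite /ltmx BZ; apply: contra znB'; exact: submx_trans.
  by rewrite ltmxErank => /andP[].
by rewrite /betti -/B -/Z; lia.
Qed.

End BettiNumbers.

(** * Letterplace ideals *)

Section Letterplace.

Variables (k : fieldType) (n : nat) (disp : Order.disp_t).
Variable P : finPOrderType disp.
Implicit Types U R : {set 'I_n * P}.

Lemma mdeg_graph (f : {ffun 'I_n -> P}) :
  \prod_(i < n) lvar k i (f i)
  = 'X_[mdeg_set [set w | f w.1 == w.2]] :> {mpoly k[nvars n P]}.
Proof.
rewrite -(big_morph (fun m => 'X_[m]) (@mpolyXD _ _) (@mpolyX0 _ _)).
congr 'X_[_]; apply/mnmP => x.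
rewrite mnm_sumE /mdeg_set mnmE -{1}[x]enum_valK.
case: (enum_val x) => i p; rewrite inE /=.
rewrite (bigD1 i) //= mnm1E (inj_eq enum_rank_inj) xpair_eqE eqxx /=.
rewrite big1 ?addn0 // => j ji.
by rewrite mnm1E (inj_eq enum_rank_inj) xpair_eqE (negbTE ji).
Qed.

Lemma mdeg_set_lep U V : (mdeg_set U <= mdeg_set V)%MM = (U \subset V).
Proof.
apply/mnm_lepP/subsetP => UV x.
  move=> Ux; have := UV (enum_rank x); rewrite /mdeg_set !mnmE enum_rankK Ux.
  by case: (x \in V).
rewrite /mdeg_set !mnmE; have := UV (enum_val x).
by case: (_ \in U) => // /(_ isT) ->.
Qed.

(** Comparing coefficients of the monomial of [U] shows that some generator divides
    it. *)
Lemma letterplace_monomial U : letterplace (k := k) (n := n) (P := P) 'X_[mdeg_set U] <->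
  exists2 f : {ffun 'I_n -> P}, multichain f & forall i, (i, f i) \in U.
Proof.
split=> [[c UE]|[f fm fU]].
  apply: NNPP => no; have := congr1 (mcoeff (mdeg_set U)) UE.
  rewrite mcoeffX eqxx raddf_sum big1 /= => [/eqP|f fm]; first by rewrite oner_eq0.
  rewrite mdeg_graph mcoeffMX_nlep // mdeg_set_lep; apply/negP => /subsetP fU.
  by apply: no; exists f => // i; apply: fU; rewrite inE.
exists (fun g => if g == f then 'X_[mdeg_set U - mdeg_set [set w | f w.1 == w.2]] else 0).
rewrite (bigD1 f) //= eqxx mdeg_graph -mpolyXD submK ?big1 ?addr0 //.
  by move=> g /andP[_ /negbTE ->]; rewrite mul0r.
rewrite mdeg_set_lep; apply/subsetP => -[i p]; rewrite inE /= => /eqP <-.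
exact: fU.
Qed.

(** A finite multichain is continued beyond the last layer by its last value. *)
Lemma letterplace_tail U : (0 < n)%N ->
  contains_set (@letterplace k n disp P) U <->
  tail_ideal [set: P] (fun=> 0%N) U.
Proof.
move=> n_gt0; rewrite /contains_set letterplace_monomial; split.
  case=> f /forallP fm fU.
  have clamp l : (minn l n.-1 < n)%N by rewrite gtn_min; apply/orP; right; lia.
  pose g l := f (Ordinal (clamp l)).
  exists (g 0%N); rewrite ?inE //; exists g; split=> //.
    move=> x y xy; have /forallP/(_ (Ordinal (clamp y)))/implyP := fm (Ordinal (clamp x)).
    by apply=> /=; lia.
  move=> l _; rewrite /g (_ : Ordinal (clamp l) = l) //.
  by apply/val_inj => /=; have := ltn_ord l; lia.
case=> q _ [f [fh _ fU]]; exists [ffun i : 'I_n => f i].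
  by apply/forallP => i; apply/forallP => j; apply/implyP => ij; rewrite !ffunE fh.
by move=> i; rewrite ffunE fU.
Qed.

Lemma letterplace_proper : (0 < n)%N -> ~ contains_set (@letterplace k n disp P) set0.
Proof.
move=> n_gt0 /(letterplace_tail _ n_gt0)[q _ [f [_ _ /(_ (Ordinal n_gt0) isT)]]].
by rewrite inE.
Qed.

End Letterplace.

Theorem proposition3p17 (disp : Order.disp_t) (P : finPOrderType disp)
    (hP : (0 < #|P|)%N) (k : fieldType) (n : nat) (hn : (0 < n)%N)
    (R : {set 'I_n * P})
    (F : graded_free_resolution (@letterplace k n disp P)) :
  (betti F #|P|.-1 (mdeg_set R) <> 0%N <->
     [/\ layers_increasing R, layers_cover R & layers_glue R])
  /\
  ([/\ layers_increasing R, layers_cover R & layers_glue R] ->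
     betti F #|P|.-1 (mdeg_set R) = 1%N).
Proof.
have pres : presents (contains_set (@letterplace k n disp P)) [set: P] (fun=> 0%N) R R.
  split=> // X _ XR.
  by rewrite (setIidPl XR); exact: letterplace_tail.
have cardP : #|[set: P]| = #|P|.-1.+1 by rewrite cardsT prednK.
have proper := letterplace_proper (k := k) (P := P) hn.
have [line acyc] := tight_homology (squarefree_part F) pres.
rewrite cardP in line acyc.
have one : tight [set: P] (fun=> 0%N) R -> betti F #|P|.-1 (mdeg_set R) = 1%N.
  by move=> ti; apply: (betti_line proper); exact: line.
rewrite -(tight_layersP R hn hP); split=> //; split=> [|/one -> //].
by move=> nz; apply: NNPP => nt; apply: nz; apply: (betti_acyclic proper); exact: acyc.
Qed.
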